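(* Assume the Combinatorial 4-Clique hypothesis. Then any combinatorial algorithm computing $(s,t)$-earliest arrival ({\rm stEA}) on $n$-node directed graphs under only edge-weight increases (and likewise under only edge-weight decreases) requires $n^{2-o(1)}$ amortized update time. This holds even for update sequences in which each edge weight is modified only once.
   Context: In a directed edge-weighted graph, a valid itinerary is a path whose edge weights are non-decreasing along it; its arrival value is the weight of its last edge. {\rm stEA} asks to maintain $\mathbf{a}(s,t)$, the minimum arrival value over valid itineraries from fixed $s$ to fixed $t$. In the weight-dynamic model, updates change the weight of an existing edge; incremental means weights only increase, decremental means weights only decrease. ''Combinatorial'' refers to algorithms not using fast-matrix-multiplication-type algebraic techniques. Combinatorial 4-Clique hypothesis: for no $\varepsilon>0$ is there an $O(n^{4-\varepsilon})$ combinatorial algorithm deciding whether an $n$-node graph contains a 4-clique. *)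

(* Defs.v *)
From Stdlib Require Import Reals List Sorted Bool Arith.
Import ListNotations.

(** * Word RAM

    Deterministic word RAM with [w]-bit words: every value computed is reduced
    modulo [2 ^ w].  Programs are structured commands over word registers and
    statically named word arrays, both initially zero outside the input.  Every
    assignment, store and test costs one step; expressions have constant size
    in a fixed program. *)

Inductive binop : Set :=
  Add | Sub | Mul | Div | Mod | And | Or | Xor | Shl | Shr | Eq | Lt.

Definition eval_binop (o : binop) : nat -> nat -> nat :=
  match o with
  | Add => Nat.add | Sub => Nat.sub | Mul => Nat.mul
  | Div => Nat.div | Mod => Nat.modulo
  | And => Nat.land | Or => Nat.lor | Xor => Nat.lxor
  | Shl => Nat.shiftl | Shr => Nat.shiftr
  | Eq => fun x y => Nat.b2n (x =? y)
  | Lt => fun x y => Nat.b2n (x <? y)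
  end.

Inductive exp : Set :=
  | Cst (k : nat)
  | Reg (r : nat)
  | Arr (a : nat) (i : exp)
  | Bin (o : binop) (e1 e2 : exp).

Inductive cmd : Set :=
  | Skip
  | Assign (r : nat) (e : exp)
  | Store (a : nat) (i e : exp)
  | Seq (c1 c2 : cmd)
  | If (e : exp) (c1 c2 : cmd)
  | While (e : exp) (c : cmd).

Record state : Type := State { reg : nat -> nat; arr : nat -> nat -> nat }.

Definition set_reg (r x : nat) (st : state) : state :=
  State (fun r' => if r' =? r then x else reg st r') (arr st).

Definition set_arr (a i x : nat) (st : state) : state :=
  State (reg st)
        (fun a' i' => if (a' =? a) && (i' =? i) then x else arr st a' i').

Fixpoint eval (w : nat) (st : state) (e : exp) : nat :=
  match e with
  | Cst k => k mod 2 ^ w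
  | Reg r => reg st r
  | Arr a i => arr st a (eval w st i)
  | Bin o e1 e2 => eval_binop o (eval w st e1) (eval w st e2) mod 2 ^ w
  end.

(** [exec w c st st' k]: with word size [w], [c] started in [st] halts in [st']
    after [k] steps. *)
Inductive exec (w : nat) : cmd -> state -> state -> nat -> Prop :=
  | exec_skip st : exec w Skip st st 0
  | exec_assign r e st :
      exec w (Assign r e) st (set_reg r (eval w st e) st) 1
  | exec_store a i e st :
      exec w (Store a i e) st (set_arr a (eval w st i) (eval w st e) st) 1
  | exec_seq c1 c2 st st1 st2 k1 k2 :
      exec w c1 st st1 k1 -> exec w c2 st1 st2 k2 ->
      exec w (Seq c1 c2) st st2 (k1 + k2)
  | exec_if_true e c1 c2 st st' k :
      eval w st e <> 0 -> exec w c1 st st' k ->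
      exec w (If e c1 c2) st st' (S k)
  | exec_if_false e c1 c2 st st' k :
      eval w st e = 0 -> exec w c2 st st' k ->
      exec w (If e c1 c2) st st' (S k)
  | exec_while_true e c st st1 st2 k1 k2 :
      eval w st e <> 0 -> exec w c st st1 k1 ->
      exec w (While e c) st1 st2 k2 ->
      exec w (While e c) st st2 (S (k1 + k2))
  | exec_while_false e c st :
      eval w st e = 0 -> exec w (While e c) st st 1.

(** Words have Omega(log n) bits: an algorithm chooses [c] and must then work
    for every word size [w] with [word_size c n w]. *)
Definition word_size (c n w : nat) : Prop := c * S (Nat.log2 n) <= w.

(** [T = O(n ^ e)]; [Rpower] is meaningful for positive bases only. *)
Definition bigO_pow (T : nat -> nat) (e : R) : Prop :=
  exists C : R, forall n : nat, 1 <= n ->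
    (INR (T n) <= C * Rpower (INR n) e)%R.

(** * 4-Clique *)

Definition simple_graph (n : nat) (A : nat -> nat -> bool) : Prop :=
  forall i j, i < n -> j < n -> A i i = false /\ A i j = A j i.

(** The four vertices are distinct since [A] is irreflexive. *)
Definition has_4clique (n : nat) (A : nat -> nat -> bool) : Prop :=
  exists a b c d, a < n /\ b < n /\ c < n /\ d < n /\
    A a b = true /\ A a c = true /\ A a d = true /\
    A b c = true /\ A b d = true /\ A c d = true.

(** Input: [n] in register 0, the adjacency matrix row by row in array 0. *)
Definition clique_input (n : nat) (A : nat -> nat -> bool) : state :=
  State (fun r => if r =? 0 then n else 0)
        (fun a p => if (a =? 0) && (p <? n * n)
                    then Nat.b2n (A (p / n) (p mod n)) else 0).

(** Output: register 2 is nonzero iff the answer is yes. *)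
Definition decides_4clique (P : cmd) : Prop :=
  exists c, forall n A w, simple_graph n A -> word_size c n w ->
    exists st k, exec w P (clique_input n A) st k /\
                 (reg st 2 <> 0 <-> has_4clique n A).

Definition clique_time (P : cmd) (T : nat -> nat) : Prop :=
  exists c, forall n A w st k, simple_graph n A -> word_size c n w ->
    exec w P (clique_input n A) st k -> k <= T n.

(** * Earliest arrival *)

(** [G i j = Some x] iff there is an edge from [i] to [j], of weight [x]; only
    vertices smaller than the number of nodes are considered. *)
Definition wgraph : Type := nat -> nat -> option nat.

(** A walk is listed as the successive (head, weight) pairs of its edges.  The
    minimum arrival value over walks and over simple paths is the same: cutting
    out a closed subwalk keeps the weights non-decreasing and cannot increase
    the arrival value at a vertex distinct from the source. *)
Fixpoint walk (n : nat) (G : wgraph) (u : nat) (p : list (nat * nat)) (v : nat)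
  : Prop :=
  match p with
  | [] => u = v
  | (u', x) :: p' => u' < n /\ G u u' = Some x /\ walk n G u' p' v
  end.

Definition valid_itinerary (n : nat) (G : wgraph) (u : nat)
    (p : list (nat * nat)) (v : nat) : Prop :=
  walk n G u p v /\ Sorted le (map snd p).

Definition arrival (p : list (nat * nat)) : nat := last (map snd p) 0.

(** [a(s,t)], for distinct [s] and [t]; [None] when there is no valid
    itinerary. *)
Definition earliest_arrival (n : nat) (G : wgraph) (s t : nat) (o : option nat)
  : Prop :=
  match o with
  | Some a => (exists p, valid_itinerary n G s p t /\ arrival p = a) /\
              (forall p, valid_itinerary n G s p t -> a <= arrival p)
  | None => forall p, ~ valid_itinerary n G s p t
  end.

(** * Dynamic algorithms for stEA *)

Inductive direction : Set := Incremental | Decremental.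

(** [((u, v), x)]: the weight of the edge from [u] to [v] becomes [x]. *)
Definition upd : Type := ((nat * nat) * nat)%type.

Definition apply_upd (z : upd) (G : wgraph) : wgraph :=
  fun i j => if (i =? fst (fst z)) && (j =? snd (fst z))
             then Some (snd z) else G i j.

Definition legal_upd (d : direction) (n w : nat) (G : wgraph) (z : upd) : Prop :=
  let '((u, v), x) := z in
  u < n /\ v < n /\ x < 2 ^ w /\
  exists y, G u v = Some y /\
    match d with Incremental => y < x | Decremental => x < y end.

Fixpoint legal_upds (d : direction) (n w : nat) (G : wgraph) (us : list upd)
  : Prop :=
  match us with
  | [] => True
  | z :: us' => legal_upd d n w G z /\ legal_upds d n w (apply_upd z G) us'
  end.

(** Loop-free digraph whose weights fit in a word, two distinct terminals, and
    monotone updates; if [once] then no edge is updated twice. *)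
Definition legal_instance (d : direction) (once : bool) (n w : nat) (G : wgraph)
    (s t : nat) (us : list upd) : Prop :=
  s < n /\ t < n /\ s <> t /\
  (forall i, i < n -> G i i = None) /\
  (forall i j x, i < n -> j < n -> G i j = Some x -> x < 2 ^ w) /\
  legal_upds d n w G us /\
  (once = true -> NoDup (map fst us)).

Record dyn_alg : Set := DynAlg { init : cmd; update : cmd }.

(** Input of [init]: [n], [s], [t] in registers 0, 1, 2; the edge indicators
    and the edge weights, row by row, in arrays 0 and 1. *)
Definition ea_input (n : nat) (G : wgraph) (s t : nat) : state :=
  State (fun r => match r with 0 => n | 1 => s | 2 => t | _ => 0 end)
        (fun a p =>
           if p <? n * n then
             match a, G (p / n) (p mod n) with
             | 0, Some _ => 1
             | 1, Some x => x
             | _, _ => 0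
             end
           else 0).

(** Input of [update]: [u], [v], [x] in registers 3, 4, 5; the rest of the
    state is what the previous operation left. *)
Definition upd_input (z : upd) (st : state) : state :=
  set_reg 5 (snd z) (set_reg 4 (snd (fst z)) (set_reg 3 (fst (fst z)) st)).

(** The maintained output: register 6 tells whether [t] can be reached, and if
    so register 7 holds [a(s,t)]. *)
Definition ea_output (st : state) : option nat :=
  if reg st 6 =? 0 then None else Some (reg st 7).

(** [maintains .. us k]: from [st], in which [a(s,t)] is correct for [G], the
    updates [us] are processed in [k] steps altogether, and [a(s,t)] is correct
    after each of them. *)
Inductive maintains (D : dyn_alg) (n s t w : nat) :
    wgraph -> state -> list upd -> nat -> Prop :=
  | maintains_nil G st :
      earliest_arrival n G s t (ea_output st) ->
      maintains D n s t w G st [] 0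
  | maintains_cons G st z us st' k k' :
      earliest_arrival n G s t (ea_output st) ->
      exec w (update D) (upd_input z st) st' k ->
      maintains D n s t w (apply_upd z G) st' us k' ->
      maintains D n s t w G st (z :: us) (k + k').

Definition ea_run (D : dyn_alg) (n w : nat) (G : wgraph) (s t : nat)
    (us : list upd) (k : nat) : Prop :=
  exists st k0 k1, exec w (init D) (ea_input n G s t) st k0 /\
    maintains D n s t w G st us k1 /\ k = k0 + k1.

Definition solves_stEA (d : direction) (once : bool) (D : dyn_alg) : Prop :=
  exists c, forall n w G s t us,
    word_size c n w -> legal_instance d once n w G s t us ->
    exists k, ea_run D n w G s t us k.

(** Amortized update time [U], loading the initial graph being charged like
    [n ^ 2] updates (a digraph has at most that many edges).  Some allowance
    for reading the initial graph is needed, as sequences may be short; a larger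
    one makes a lower bound on [U] stronger. *)
Definition amortized_update_time (d : direction) (once : bool) (D : dyn_alg)
    (U : nat -> nat) : Prop :=
  exists c, forall n w G s t us k,
    word_size c n w -> legal_instance d once n w G s t us ->
    ea_run D n w G s t us k -> k <= U n * (n ^ 2 + length us).

(** * Combinatorial algorithms

    "Combinatorial" has no mathematical definition.  It is kept as an arbitrary
    pair of classes, of static and of dynamic algorithms, that is closed under
    the reductions below.

    Closure under arbitrary reductions would be absurd: a reduction may itself
    multiply matrices.  The reductions allowed here are too weak for that:
    [glue] code owns finitely many registers and no array, reads the input of
    4-Clique, and drives one dynamic algorithm without ever seeing its answers;
    these are only used to say "yes" once [a(s,t) <= e] for some [e]. *)

Inductive glue : Set :=
  | GAssign (r : nat) (e : exp)
  | GSeq (g1 g2 : glue)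
  | GIf (e : exp) (g1 g2 : glue)
  | GWhile (e : exp) (g : glue)
  | GSkip
  | GArg (r : nat) (e : exp)
  | GSend (a : nat) (i e : exp)
  | GInit
  | GUpdate
  | GAccept (e : exp).

Fixpoint rename_exp (f : nat -> nat) (e : exp) : exp :=
  match e with
  | Cst k => Cst k
  | Reg r => Reg (f r)
  | Arr a i => Arr (f a) (rename_exp f i)
  | Bin o e1 e2 => Bin o (rename_exp f e1) (rename_exp f e2)
  end.

Fixpoint rename_cmd (f : nat -> nat) (c : cmd) : cmd :=
  match c with
  | Skip => Skip
  | Assign r e => Assign (f r) (rename_exp f e)
  | Store a i e => Store (f a) (rename_exp f i) (rename_exp f e)
  | Seq c1 c2 => Seq (rename_cmd f c1) (rename_cmd f c2)
  | If e c1 c2 => If (rename_exp f e) (rename_cmd f c1) (rename_cmd f c2)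
  | While e c1 => While (rename_exp f e) (rename_cmd f c1)
  end.

(** Names of the glue code, and of the dynamic algorithm, in the program that
    combines them; neither contains 2, the output register of 4-Clique. *)
Definition glue_name (r : nat) : nat := 3 * r.
Definition dyn_name (r : nat) : nat := 3 * r + 1.

Fixpoint inline (D : dyn_alg) (g : glue) : cmd :=
  match g with
  | GAssign r e => Assign (glue_name r) (rename_exp glue_name e)
  | GSeq g1 g2 => Seq (inline D g1) (inline D g2)
  | GIf e g1 g2 =>
      If (rename_exp glue_name e) (inline D g1) (inline D g2)
  | GWhile e g1 => While (rename_exp glue_name e) (inline D g1)
  | GSkip => Skip
  | GArg r e => Assign (dyn_name r) (rename_exp glue_name e)
  | GSend a i e =>
      Store (dyn_name a) (rename_exp glue_name i) (rename_exp glue_name e)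
  | GInit => rename_cmd dyn_name (init D)
  | GUpdate => rename_cmd dyn_name (update D)
  | GAccept e =>
      If (Reg (dyn_name 6))
         (If (Bin Lt (rename_exp glue_name e) (Reg (dyn_name 7)))
             Skip (Assign 2 (Cst 1)))
         Skip
  end.

(** [g] uses the dynamic algorithm only through its specification. *)
Definition black_box_reduction (d : direction) (once : bool) (g : glue) : Prop :=
  forall D, solves_stEA d once D -> decides_4clique (inline D g).

Definition combinatorial_notion (comb : cmd -> Prop) (comb_dyn : dyn_alg -> Prop)
  : Prop :=
  forall d once D g,
    comb_dyn D -> solves_stEA d once D -> black_box_reduction d once g ->
    comb (inline D g).

Definition combinatorial_4clique_hypothesis (comb : cmd -> Prop) : Prop :=
  forall eps : R, (0 < eps)%R ->
    ~ exists P T, comb P /\ decides_4clique P /\ clique_time P T /\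
                  bigO_pow T (4 - eps).

(** [U] is [n ^ (2 - o(1))] or larger, in the usual fine-grained sense. *)
Definition at_least_quadratic_up_to_subpoly (U : nat -> nat) : Prop :=
  forall eps : R, (0 < eps)%R -> ~ bigO_pow U (2 - eps).

(* Main.v *)
From Stdlib Require Import Reals List Sorted Bool Arith Lia Lra FunctionalExtensionality.
Require Import Defs.
Import ListNotations.

(** A clique [a, b, c, c'] is sought in phases [(a, b)], [a] in the outer loop,
    along walks [s -> b -> c -> c' -> b -> t]; the steps between the four stages
    [b, c, c', b] exist only along edges of the input graph and have one weight
    per stage.  Within stage [k], a vertex [i] is entered at [In_ k i] and must be
    left at [Out k i], which is to be possible iff [a] is adjacent to [i] and, in
    stages 0 and 3, [i = b].

    Weights being monotone and changed only once, an edge cannot be opened and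
    closed again and again.  So stage [k] has [2 n] middle vertices, and in outer
    phase [a] vertex [i] passes through the middle vertex [a + i]: the first half
    of this passage is switched on, the second half is later switched off, each
    edge being updated once.  Passages of an earlier phase [a0] enter a middle
    vertex and those of a later phase [a1] leave it, but such combinations are
    excluded by weights decreasing with the phase.  A passage thus stays within
    phase [a], and its middle vertex determines [i].  In stages 0 and 3 the passage of
    [i] is moreover switched off again right after phase [(a, i)]. *)

(** * Programs under renaming of registers and arrays *)

Definition view (f : nat -> nat) (st : state) : state :=
  State (fun r => reg st (f r)) (fun a => arr st (f a)).

Lemma eval_rename (w : nat) (f : nat -> nat) (st : state) (e : exp) :
  eval w st (rename_exp f e) = eval w (view f st) e.
Proof.
  induction e as [k | r | a i IH | o e1 IH1 e2 IH2]; simpl; congruence.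
Qed.

(** [clique_time] speaks of every halting run, while the analysis of the reduction constructs one;
    determinism identifies the two. *)
Lemma exec_deterministic (w : nat) (c : cmd) (st st1 st2 : state) (k1 k2 : nat) :
  exec w c st st1 k1 -> exec w c st st2 k2 -> st1 = st2 /\ k1 = k2.
Proof.
  intros H; revert st2 k2.
  induction H; intros st9 k9 H9; inversion H9; subst; try easy;
    repeat match goal with
    | IH : forall st2 k2, exec w ?c ?st st2 k2 -> _, X : exec w ?c ?st _ _ |- _ =>
        apply IH in X; destruct X as [-> ->]
    end; easy.
Qed.

Lemma view_set_reg (f : nat -> nat) (r x : nat) (st : state) :
  (forall p q, f p = f q -> p = q) ->
  view f (set_reg (f r) x st) = set_reg r x (view f st).
Proof.
  intros Hf; unfold view, set_reg; simpl; f_equal.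
  apply functional_extensionality; intros q.
  destruct (Nat.eqb_spec q r) as [-> | Hqr]; [now rewrite Nat.eqb_refl |].
  destruct (Nat.eqb_spec (f q) (f r)) as [E | _]; [apply Hf in E |]; easy.
Qed.

Lemma view_set_arr (f : nat -> nat) (a i x : nat) (st : state) :
  (forall p q, f p = f q -> p = q) ->
  view f (set_arr (f a) i x st) = set_arr a i x (view f st).
Proof.
  intros Hf; unfold view, set_arr; simpl; f_equal.
  apply functional_extensionality; intros q.
  apply functional_extensionality; intros j.
  destruct (Nat.eqb_spec q a) as [-> | Hqa]; [now rewrite Nat.eqb_refl |].
  destruct (Nat.eqb_spec (f q) (f a)) as [E | _]; [apply Hf in E |]; easy.
Qed.

Lemma view_set_reg_other (f : nat -> nat) (r x : nat) (st : state) :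
  (forall q, f q <> r) -> view f (set_reg r x st) = view f st.
Proof.
  intros Hf; unfold view, set_reg; simpl; f_equal.
  apply functional_extensionality; intros q.
  destruct (Nat.eqb_spec (f q) r) as [E | _]; [now apply Hf in E | easy].
Qed.

Lemma view_set_arr_other (f : nat -> nat) (a i x : nat) (st : state) :
  (forall q, f q <> a) -> view f (set_arr a i x st) = view f st.
Proof.
  intros Hf; unfold view, set_arr; simpl; f_equal.
  apply functional_extensionality; intros q.
  apply functional_extensionality; intros j.
  destruct (Nat.eqb_spec (f q) a) as [E | _]; [now apply Hf in E | easy].
Qed.

(** The last two conclusions are a frame condition: names outside the range of [f] keep their
    contents, which protects the glue code and the answer register while the dynamic algorithm
    runs. *)
Lemma exec_rename (w : nat) (f : nat -> nat) (c : cmd) (st st' : state) (k : nat) :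
  (forall p q, f p = f q -> p = q) ->
  exec w c st st' k ->
  forall s, view f s = st ->
  exists s', exec w (rename_cmd f c) s s' k /\ view f s' = st' /\
    (forall r, (forall q, f q <> r) -> reg s' r = reg s r) /\
    (forall a, (forall q, f q <> a) -> arr s' a = arr s a).
Proof.
  intros Hf H.
  induction H as [st | r e st | a i e st
    | c1 c2 st st1 st2 k1 k2 _ IH1 _ IH2
    | e c1 c2 st st' k He _ IH | e c1 c2 st st' k He _ IH
    | e c st st1 st2 k1 k2 He _ IH1 _ IH2 | e c st He];
    intros s Hs; simpl.
  - exists s; repeat split; [constructor | easy].
  - exists (set_reg (f r) (eval w s (rename_exp f e)) s).
    split; [constructor |].
    rewrite view_set_reg, eval_rename, Hs by easy.
    repeat split; intros q Hq; simpl.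
    destruct (Nat.eqb_spec q (f r)) as [-> |]; [now destruct (Hq r) | easy].
  - exists (set_arr (f a) (eval w s (rename_exp f i)) (eval w s (rename_exp f e)) s).
    split; [constructor |].
    rewrite view_set_arr, !eval_rename, Hs by easy.
    repeat split; intros q Hq; simpl.
    apply functional_extensionality; intros j.
    destruct (Nat.eqb_spec q (f a)) as [-> |]; [now destruct (Hq a) | easy].
  - destruct (IH1 s Hs) as (s1 & E1 & V1 & R1 & A1).
    destruct (IH2 s1 V1) as (s2 & E2 & V2 & R2 & A2).
    exists s2; split; [now apply exec_seq with s1 |].
    repeat split; [easy | |]; intros q Hq.
    + now rewrite R2, R1.
    + now rewrite A2, A1.
  - destruct (IH s Hs) as (s1 & E1 & V1 & R1 & A1).
    exists s1; split; [| easy].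
    apply exec_if_true; [now rewrite eval_rename, Hs | easy].
  - destruct (IH s Hs) as (s1 & E1 & V1 & R1 & A1).
    exists s1; split; [| easy].
    apply exec_if_false; [now rewrite eval_rename, Hs | easy].
  - destruct (IH1 s Hs) as (s1 & E1 & V1 & R1 & A1).
    destruct (IH2 s1 V1) as (s2 & E2 & V2 & R2 & A2).
    exists s2; split.
    { apply exec_while_true with s1; [now rewrite eval_rename, Hs | easy | easy]. }
    repeat split; [easy | |]; intros q Hq.
    + now rewrite R2, R1.
    + now rewrite A2, A1.
  - exists s; split; [| easy].
    apply exec_while_false; now rewrite eval_rename, Hs.
Qed.

(** * Traces of glue code *)

Inductive op : Set :=
  | OArg (r x : nat)
  | OSend (a i x : nat)
  | OInit
  | OUpdate
  | OAccept (x : nat).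

(** Since glue code never sees the answers, the operations that it issues do not
    depend on the dynamic algorithm. *)
Inductive gexec (w : nat) (inp : nat -> nat -> nat) :
    glue -> (nat -> nat) -> (nat -> nat) -> list op -> nat -> Prop :=
  | gexec_assign r e rho :
      gexec w inp (GAssign r e) rho
        (fun q => if q =? r then eval w (State rho inp) e else rho q) [] 1
  | gexec_seq g1 g2 rho rho1 rho2 tr1 tr2 k1 k2 :
      gexec w inp g1 rho rho1 tr1 k1 -> gexec w inp g2 rho1 rho2 tr2 k2 ->
      gexec w inp (GSeq g1 g2) rho rho2 (tr1 ++ tr2) (k1 + k2)
  | gexec_if_true e g1 g2 rho rho' tr k :
      eval w (State rho inp) e <> 0 -> gexec w inp g1 rho rho' tr k ->
      gexec w inp (GIf e g1 g2) rho rho' tr (S k)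
  | gexec_if_false e g1 g2 rho rho' tr k :
      eval w (State rho inp) e = 0 -> gexec w inp g2 rho rho' tr k ->
      gexec w inp (GIf e g1 g2) rho rho' tr (S k)
  | gexec_while_true e g rho rho1 rho2 tr1 tr2 k1 k2 :
      eval w (State rho inp) e <> 0 -> gexec w inp g rho rho1 tr1 k1 ->
      gexec w inp (GWhile e g) rho1 rho2 tr2 k2 ->
      gexec w inp (GWhile e g) rho rho2 (tr1 ++ tr2) (S (k1 + k2))
  | gexec_while_false e g rho :
      eval w (State rho inp) e = 0 -> gexec w inp (GWhile e g) rho rho [] 1
  | gexec_skip rho : gexec w inp GSkip rho rho [] 0
  | gexec_arg r e rho :
      gexec w inp (GArg r e) rho rho [OArg r (eval w (State rho inp) e)] 1
  | gexec_send a i e rho :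
      gexec w inp (GSend a i e) rho rho
        [OSend a (eval w (State rho inp) i) (eval w (State rho inp) e)] 1
  | gexec_init rho : gexec w inp GInit rho rho [OInit] 0
  | gexec_update rho : gexec w inp GUpdate rho rho [OUpdate] 0
  | gexec_accept e rho :
      gexec w inp (GAccept e) rho rho [OAccept (eval w (State rho inp) e)] 0.

Definition accepted (st : state) (x : nat) : bool :=
  negb (reg st 6 =? 0) && (reg st 7 <=? x).

(** The last argument only bounds the number of steps, an acceptance test being
    charged 3. *)
Inductive play (D : dyn_alg) (w : nat) :
    state -> bool -> list op -> state -> bool -> nat -> Prop :=
  | play_nil st b : play D w st b [] st b 0
  | play_arg r x st b tr st' b' k :
      play D w (set_reg r x st) b tr st' b' k ->
      play D w st b (OArg r x :: tr) st' b' k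
  | play_send a i x st b tr st' b' k :
      play D w (set_arr a i x st) b tr st' b' k ->
      play D w st b (OSend a i x :: tr) st' b' k
  | play_init st b st1 k1 tr st' b' k :
      exec w (init D) st st1 k1 -> play D w st1 b tr st' b' k ->
      play D w st b (OInit :: tr) st' b' (k1 + k)
  | play_update st b st1 k1 tr st' b' k :
      exec w (update D) st st1 k1 -> play D w st1 b tr st' b' k ->
      play D w st b (OUpdate :: tr) st' b' (k1 + k)
  | play_accept x st b tr st' b' k :
      play D w st (b || accepted st x) tr st' b' k ->
      play D w st b (OAccept x :: tr) st' b' (3 + k).

Lemma play_app (D : dyn_alg) (w : nat) (tr1 tr2 : list op)
    (st st1 st2 : state) (b b1 b2 : bool) (k1 k2 : nat) :
  play D w st b tr1 st1 b1 k1 -> play D w st1 b1 tr2 st2 b2 k2 ->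
  play D w st b (tr1 ++ tr2) st2 b2 (k1 + k2).
Proof.
  induction 1; intros H2; simpl; rewrite <- ?Nat.add_assoc;
    try (econstructor; eauto; fail); easy.
Qed.

Lemma play_app_inv (D : dyn_alg) (w : nat) (tr1 tr2 : list op)
    (st st2 : state) (b b2 : bool) (k : nat) :
  play D w st b (tr1 ++ tr2) st2 b2 k ->
  exists st1 b1 k1 k2, play D w st b tr1 st1 b1 k1 /\
    play D w st1 b1 tr2 st2 b2 k2 /\ k = k1 + k2.
Proof.
  revert st b k; induction tr1 as [| o tr1 IH]; intros st b k H.
  - exists st, b, 0, k; repeat split; [constructor | easy].
  - inversion H; subst;
      match goal with X : play _ _ _ _ (tr1 ++ tr2) _ _ _ |- _ =>
        apply IH in X; destruct X as (st1' & b1' & k1' & k2' & X1 & X2 & ->) end;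
      exists st1', b1'; do 2 eexists; (split; [econstructor; eauto |]);
      (split; [eassumption | lia]).
Qed.

(** The combined state splits by name: multiples of 3 for the glue code, residue 1 for the dynamic
    algorithm, register 2 for the answer. The glue arrays stay equal to the input [inp] because no
    glue command stores into them. *)
Definition linked (st : state) (rho : nat -> nat) (inp : nat -> nat -> nat)
    (dst : state) (b : bool) : Prop :=
  view glue_name st = State rho inp /\ view dyn_name st = dst /\
  reg st 2 = Nat.b2n b.

(** Simulation by induction on the glue execution: the trace tells which part of the [play] belongs
    to each subprogram, and [play_app_inv] cuts it there. *)
Lemma inline_play (D : dyn_alg) (w : nat) (inp : nat -> nat -> nat) (g : glue)
    (rho rho' : nat -> nat) (tr : list op) (kg : nat) :
  0 < w ->
  gexec w inp g rho rho' tr kg ->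
  forall st dst b dst' b' kp,
  linked st rho inp dst b -> play D w dst b tr dst' b' kp ->
  exists st' k, exec w (inline D g) st st' k /\ k <= kg + kp /\
    linked st' rho' inp dst' b'.
Proof.
  intros Hw H.
  assert (glue_inj : forall p q, glue_name p = glue_name q -> p = q)
    by (unfold glue_name; lia).
  assert (dyn_inj : forall p q, dyn_name p = dyn_name q -> p = q)
    by (unfold dyn_name; lia).
  assert (glue_dyn : forall p q, glue_name p <> dyn_name q)
    by (unfold glue_name, dyn_name; lia).
  assert (dyn_glue : forall p q, dyn_name p <> glue_name q)
    by (unfold glue_name, dyn_name; lia).
  assert (glue_2 : forall p, glue_name p <> 2) by (unfold glue_name; lia).
  assert (dyn_2 : forall p, dyn_name p <> 2) by (unfold dyn_name; lia).
  (* Shared by [GInit] and [GUpdate]: a call changes the dynamic part only. *)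
  assert (run : forall c st dst b rho st1 k1,
    linked st rho inp dst b -> exec w c dst st1 k1 ->
    exists st', exec w (rename_cmd dyn_name c) st st' k1 /\
      linked st' rho inp st1 b).
  { intros c st dst b rh st1 k1 (Vg & Vd & H2) E.
    destruct (exec_rename _ dyn_name _ _ _ _ dyn_inj E _ Vd)
      as (st' & E' & V' & R' & A').
    exists st'; split; [easy |]; split; [| split; [easy |]].
    - rewrite <- Vg; unfold view; f_equal; apply functional_extensionality;
        intros q; [apply R' | apply A']; intros p; apply dyn_glue.
    - rewrite R'; [easy | apply dyn_2]. }
  induction H as [r e rho | g1 g2 rho rho1 rho2 tr1 tr2 k1 k2 _ IH1 _ IH2
    | e g1 g2 rho rho' tr k He _ IH | e g1 g2 rho rho' tr k He _ IH
    | e g rho rho1 rho2 tr1 tr2 k1 k2 He _ IH1 _ IH2 | e g rho He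
    | rho | r e rho | a i e rho | rho | rho | e rho];
    intros st dst b dst' b' kp L P; simpl;
    pose proof L as (Vg & Vd & H2).
  - inversion P; subst.
    eexists _, 1; split; [constructor |]; split; [lia |].
    split; [| split].
    + rewrite view_set_reg, eval_rename, Vg by easy; reflexivity.
    + now rewrite view_set_reg_other.
    + cbn [reg set_reg]; destruct (Nat.eqb_spec 2 (glue_name r)) as [E | _];
        [elim (glue_2 r); congruence | easy].
  - apply play_app_inv in P as (d1 & b1 & p1 & p2 & P1 & P2 & ->).
    destruct (IH1 _ _ _ _ _ _ L P1) as (s1 & n1 & E1 & N1 & L1).
    destruct (IH2 _ _ _ _ _ _ L1 P2) as (s2 & n2 & E2 & N2 & L2).
    exists s2, (n1 + n2); split; [now apply exec_seq with s1 | split; [lia | easy]].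
  - destruct (IH _ _ _ _ _ _ L P) as (s1 & n1 & E1 & N1 & L1).
    exists s1, (S n1); split; [| split; [lia | easy]].
    apply exec_if_true; [now rewrite eval_rename, Vg | easy].
  - destruct (IH _ _ _ _ _ _ L P) as (s1 & n1 & E1 & N1 & L1).
    exists s1, (S n1); split; [| split; [lia | easy]].
    apply exec_if_false; [now rewrite eval_rename, Vg | easy].
  - apply play_app_inv in P as (d1 & b1 & p1 & p2 & P1 & P2 & ->).
    destruct (IH1 _ _ _ _ _ _ L P1) as (s1 & n1 & E1 & N1 & L1).
    destruct (IH2 _ _ _ _ _ _ L1 P2) as (s2 & n2 & E2 & N2 & L2).
    exists s2, (S (n1 + n2)); split; [| split; [lia | easy]].
    apply exec_while_true with s1; [now rewrite eval_rename, Vg | easy | easy].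
  - inversion P; subst.
    exists st, 1; split; [| split; [lia | easy]].
    apply exec_while_false; now rewrite eval_rename, Vg.
  - inversion P; subst.
    exists st, 0; split; [constructor | split; [lia | easy]].
  - inversion P as [| r0 x st0 b0 tr0 st0' b0' k0 P' | | | |]; subst.
    inversion P'; subst.
    eexists _, 1; split; [constructor |]; split; [lia |].
    split; [| split].
    + now rewrite view_set_reg_other.
    + now rewrite view_set_reg, eval_rename, Vg.
    + cbn [reg set_reg]; destruct (Nat.eqb_spec 2 (dyn_name r)) as [E | _];
        [elim (dyn_2 r); congruence | easy].
  - inversion P as [| | a0 i0 x st0 b0 tr0 st0' b0' k0 P' | | |]; subst.
    inversion P'; subst.
    eexists _, 1; split; [constructor |]; split; [lia |].
    split; [| split].
    + now rewrite view_set_arr_other.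
    + now rewrite view_set_arr, !eval_rename, Vg.
    + easy.
  - inversion P as [| | | st0 b0 st1 k1 tr0 st0' b0' k0 E P' | |]; subst.
    inversion P'; subst.
    destruct (run _ _ _ _ _ _ _ L E) as (st' & E' & L').
    exists st', k1; split; [easy | split; [lia | easy]].
  - inversion P as [| | | | st0 b0 st1 k1 tr0 st0' b0' k0 E P' |]; subst.
    inversion P'; subst.
    destruct (run _ _ _ _ _ _ _ L E) as (st' & E' & L').
    exists st', k1; split; [easy | split; [lia | easy]].
  - inversion P as [| | | | | x st0 b0 tr0 st0' b0' k0 P']; subst.
    inversion P'; subst; clear P P'.
    (* With words of zero bits the outcome 1 of a comparison, and the answer 1, would be reduced to
       0. *)
    assert (two_le : 2 <= 2 ^ w)
      by (change 2 with (2 ^ 1) at 1; apply Nat.pow_le_mono_r; lia).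
    unfold accepted; simpl.
    destruct (Nat.eqb_spec (reg st (dyn_name 6)) 0) as [Z6 | Z6]; simpl.
    { exists st, 1; split; [| split; [lia |]].
      - apply exec_if_false; [easy | constructor].
      - now rewrite orb_false_r. }
    assert (HLt : eval w st (Bin Lt (rename_exp glue_name e) (Reg (dyn_name 7))) =
      Nat.b2n (eval w (State rho inp) e <? reg st (dyn_name 7))).
    { simpl; rewrite eval_rename, Vg; apply Nat.mod_small.
      destruct (_ <? _); simpl; lia. }
    destruct (Nat.leb_spec (reg st (dyn_name 7)) (eval w (State rho inp) e))
      as [Hle | Hlt].
    + eexists _, 3; split; [| split; [lia |]].
      * apply exec_if_true; [easy |]. apply exec_if_false; [| constructor].
        rewrite HLt. destruct (Nat.ltb_spec (eval w (State rho inp) e)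
          (reg st (dyn_name 7))); [lia | easy].
      * split; [| split].
        -- now rewrite view_set_reg_other.
        -- now rewrite view_set_reg_other.
        -- rewrite orb_true_r; cbn -[Nat.modulo]; rewrite Nat.mod_small by lia.
           easy.
    + exists st, 2; split; [| split; [lia |]].
      * apply exec_if_true; [easy |]. apply exec_if_true; [| constructor].
        rewrite HLt. destruct (Nat.ltb_spec (eval w (State rho inp) e)
          (reg st (dyn_name 7))); [easy | lia].
      * now rewrite orb_false_r.
Qed.

(** * The temporal graph *)

(** At [T = nat] these are the edges of the temporal graph; at [T = exp] they are symbolic edges in
    the glue code. The lists [spokes], [links], [filter_on] and so on thus serve both. *)
Inductive edge (T : Type) : Type :=
  | Start (i : T)
  | On (k : nat) (a i : T)
  | Off (k : nat) (a i : T)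
  | Link (k : nat) (i j : T)
  | Final (i : T).
Arguments Start {T}. Arguments On {T}. Arguments Off {T}.
Arguments Link {T}. Arguments Final {T}.

Inductive node : Set :=
  | Source | Sink | In_ (k i : nat) | Mid (k j : nat) | Out (k i : nat).

Definition src (e : edge nat) : node :=
  match e with
  | Start i => Source
  | On k a i => In_ k i
  | Off k a i => Mid k (a + i)
  | Link k i j => Out k i
  | Final i => Out 3 i
  end.

Definition dst (e : edge nat) : node :=
  match e with
  | Start i => In_ 0 i
  | On k a i => Mid k (a + i)
  | Off k a i => Out k i
  | Link k i j => In_ (S k) j
  | Final i => Sink
  end.

(** Each of the four stages takes a segment of [4 * n] numbers: [n] entries, [2 * n] middle
    vertices, [n] exits. The terminals come after the last segment. *)
Definition code (n : nat) (u : node) : nat :=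
  match u with
  | Source => 16 * n
  | Sink => 16 * n + 1
  | In_ k i => (4 * k) * n + i
  | Mid k j => (4 * k + 1) * n + j
  | Out k i => (4 * k + 3) * n + i
  end.

Definition order (n : nat) : nat := 16 * n + 2.

Definition node_wf (n : nat) (u : node) : Prop :=
  match u with
  | Source | Sink => True
  | In_ k i | Out k i => k < 4 /\ i < n
  | Mid k j => k < 4 /\ j < 2 * n
  end.

Definition edge_wf (n : nat) (A : nat -> nat -> bool) (e : edge nat) : Prop :=
  match e with
  | Start i | Final i => i < n
  | On k a i | Off k a i => k < 4 /\ a < n /\ i < n
  | Link k i j => k < 3 /\ i < n /\ j < n /\ A i j = true
  end.

(** A weight [0] cannot follow, and a weight [6 * n] cannot precede, the other
    weights used. *)
Definition initial_weight (d : direction) (n : nat) (e : edge nat) : nat :=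
  match e with
  | Start i => n
  | On k a i => match d with Incremental => 0 | Decremental => 6 * n end
  | Off k a i => (k + 2) * n - a
  | Link k i j => (k + 2) * n
  | Final i => 5 * n
  end.

(** The usable weight [(k + 2) * n - a] lies strictly between [0] and [6 * n]. So [On] becoming
    usable and [Off] becoming unusable are both increases, or both decreases, depending on which
    extreme value is assigned to which switch. *)
Definition final_weight (d : direction) (n : nat) (e : edge nat) : nat :=
  match e with
  | On k a i => (k + 2) * n - a
  | Off k a i => match d with Incremental => 6 * n | Decremental => 0 end
  | _ => initial_weight d n e
  end.

Definition is_switch (e : edge nat) : Prop :=
  match e with On _ _ _ | Off _ _ _ => True | _ => False end.

(** Splitting on the stage turns the products of [k] and [n] into numeral multiples of [n], within
    reach of [lia]. *)
Lemma k_cases (k : nat) : k < 4 -> k = 0 \/ k = 1 \/ k = 2 \/ k = 3.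
Proof. lia. Qed.

Lemma code_inj (n : nat) (u v : node) :
  node_wf n u -> node_wf n v -> code n u = code n v -> u = v.
Proof.
  destruct u as [| | k i | k j | k i], v as [| | k' i' | k' j' | k' i'];
    cbn -[Nat.mul Nat.add]; intros Hu Hv;
    repeat match goal with
    | H : _ /\ _ |- _ => destruct H as [H1 ?]; apply k_cases in H1;
        destruct H1 as [-> | [-> | [-> | ->]]] end;
    intros E; try lia; try easy; f_equal; lia.
Qed.

Lemma code_lt (n : nat) (u : node) : node_wf n u -> code n u < order n.
Proof.
  unfold order; destruct u as [| | k i | k j | k i]; cbn -[Nat.mul Nat.add];
    intros Hu; try lia; destruct Hu as [Hk Hi];
    apply k_cases in Hk; destruct Hk as [-> | [-> | [-> | ->]]]; lia.
Qed.

Lemma src_wf n A e : edge_wf n A e -> node_wf n (src e).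
Proof. destruct e; simpl; lia. Qed.

Lemma dst_wf n A e : edge_wf n A e -> node_wf n (dst e).
Proof. destruct e; simpl; lia. Qed.

(** The middle end of a switch only fixes the sum [a + i]; the other end supplies [i], and hence
    [a]. *)
Lemma edge_ext (e e' : edge nat) : src e = src e' -> dst e = dst e' ->
  is_switch e' -> e = e'.
Proof.
  destruct e, e'; simpl; intros Hs Hd Hw; try easy; inversion Hs; inversion Hd;
    subst; f_equal; lia.
Qed.

(** The list [edges] repeats [Start i] and [Final i] for every [a], so some entries of the graph are
    written several times; these writes have to agree. *)
Lemma initial_weight_ext d n (e e' : edge nat) :
  src e = src e' -> dst e = dst e' -> initial_weight d n e = initial_weight d n e'.
Proof.
  destruct e, e'; simpl; intros Hs Hd; try easy; inversion Hs; inversion Hd;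
    subst; try reflexivity; lia.
Qed.

(** Stages use consecutive disjoint intervals of weights, whatever the phase, so a walk may pass
    from each stage to the next; [5 * n] is the acceptance bound. *)
Lemma stage_weight (n k a : nat) : k < 4 -> a < n ->
  (k + 1) * n < (k + 2) * n - a /\ (k + 2) * n - a <= (k + 2) * n /\
  (k + 2) * n <= 5 * n.
Proof.
  intros Hk Ha; apply k_cases in Hk; destruct Hk as [-> | [-> | [-> | ->]]]; lia.
Qed.

(** * Update sequences and the graphs that they produce *)

Fixpoint apply_all (us : list upd) (G : wgraph) : wgraph :=
  match us with
  | [] => G
  | z :: us' => apply_all us' (apply_upd z G)
  end.

Lemma apply_all_app us us' G :
  apply_all (us ++ us') G = apply_all us' (apply_all us G).
Proof. revert G; induction us; simpl; auto. Qed.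

(** The witness is the last update of the edge. Which one it is need not be recorded, as in the
    lists used below all updates of an edge agree. *)
Lemma apply_all_spec (us : list upd) (G : wgraph) (u v : nat) :
  (exists z, In z us /\ fst z = (u, v) /\ apply_all us G u v = Some (snd z)) \/
  ((forall z, In z us -> fst z <> (u, v)) /\ apply_all us G u v = G u v).
Proof.
  revert G; induction us as [| z us IH]; intros G; simpl; [now right |].
  destruct (IH (apply_upd z G)) as [(y & Hy & Ey & Gy) | [Hn Gy]].
  - left; exists y; auto.
  - destruct z as [[u0 v0] x]; unfold apply_upd in Gy; simpl in Gy.
    destruct (Nat.eqb_spec u u0) as [<- | Hu]; [destruct (Nat.eqb_spec v v0) as [<- | Hv] |];
      simpl in Gy.
    + left; eexists; split; [now left | auto].
    + right; split; [| easy]; intros y [<- | Hy]; [simpl; congruence | auto].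
    + right; split; [| easy]; intros y [<- | Hy]; [simpl; congruence | auto].
Qed.

Definition set_weight (n : nat) (f : edge nat -> nat) (e : edge nat) : upd :=
  ((code n (src e), code n (dst e)), f e).

Definition spokes {T : Type} (a i : T) : list (edge T) :=
  [Start i; Final i; On 0 a i; On 1 a i; On 2 a i; On 3 a i;
   Off 0 a i; Off 1 a i; Off 2 a i; Off 3 a i].

Definition links {T : Type} (a i : T) : list (edge T) :=
  [Link 0 a i; Link 1 a i; Link 2 a i].

Definition block (A : nat -> nat -> bool) (a i : nat) : list (edge nat) :=
  spokes a i ++ (if A a i then links a i else []).

Definition edges (n : nat) (A : nat -> nat -> bool) : list (edge nat) :=
  flat_map (fun a => flat_map (fun i => block A a i) (seq 0 n)) (seq 0 n).

Lemma in_edges (n : nat) (A : nat -> nat -> bool) (e : edge nat) :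
  In e (edges n A) <-> edge_wf n A e.
Proof.
  unfold edges; rewrite in_flat_map; split.
  - intros (a & Ha & H); apply in_flat_map in H as (i & Hi & H).
    apply in_seq in Ha, Hi; unfold block in H; apply in_app_or in H as [H | H].
    + simpl in H;
      repeat (destruct H as [<- | H]; [simpl; lia |]); easy.
    + destruct (A a i) eqn:E; [| easy]; simpl in H;
      repeat (destruct H as [<- | H]; [simpl; repeat split; (lia || easy) |]); easy.
  - destruct e as [i | k a i | k a i | k i j | i]; simpl; intros H.
    1: exists i; split; [apply in_seq; lia | apply in_flat_map; exists i; split];
        [apply in_seq; lia | unfold block; simpl; auto].
    4: exists i; split; [apply in_seq; lia | apply in_flat_map; exists i; split];
        [apply in_seq; lia | unfold block; simpl; auto].
    1-2: destruct H as (Hk & Ha & Hi); exists a; split; [apply in_seq; lia |];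
      apply in_flat_map; exists i; split; [apply in_seq; lia |];
      apply k_cases in Hk; destruct Hk as [-> | [-> | [-> | ->]]];
      unfold block; simpl; tauto.
    destruct H as (Hk & Hi & Hj & HA); exists i; split; [apply in_seq; lia |].
    apply in_flat_map; exists j; split; [apply in_seq; lia |].
    apply in_or_app; right; rewrite HA.
    destruct k as [| [| [| k]]]; simpl; auto; lia.
Qed.

Definition initial_graph (d : direction) (n : nat) (A : nat -> nat -> bool) : wgraph :=
  apply_all (map (set_weight n (initial_weight d n)) (edges n A)) (fun _ _ => None).

Definition graph (d : direction) (n : nat) (A : nat -> nat -> bool)
    (L : list (edge nat)) : wgraph :=
  apply_all (map (set_weight n (final_weight d n)) L) (initial_graph d n A).

(** A relation, so that membership in [L] never has to be decided. *)
Definition weight (d : direction) (n : nat) (L : list (edge nat)) (e : edge nat)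
    (x : nat) : Prop :=
  In e L /\ x = final_weight d n e \/ ~ In e L /\ x = initial_weight d n e.

Definition switches (n : nat) (A : nat -> nat -> bool) (L : list (edge nat)) : Prop :=
  forall e, In e L -> edge_wf n A e /\ is_switch e.

Lemma initial_graph_spec d n A u v x :
  initial_graph d n A u v = Some x <->
  exists e, edge_wf n A e /\ u = code n (src e) /\ v = code n (dst e) /\
    x = initial_weight d n e.
Proof.
  unfold initial_graph.
  destruct (apply_all_spec (map (set_weight n (initial_weight d n)) (edges n A))
    (fun _ _ => None) u v) as [(z & Hz & Ez & ->) | [Hn ->]].
  - apply in_map_iff in Hz as (e & <- & He); apply in_edges in He.
    inversion Ez; subst; simpl; split.
    + intros [= <-]; exists e; auto 10.
    + intros (e' & He' & Hs & Hd & ->); f_equal; apply initial_weight_ext;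
        apply (code_inj n); eauto using src_wf, dst_wf.
  - split; [easy |].
    intros (e & He & -> & -> & ->); exfalso.
    apply (Hn (set_weight n (initial_weight d n) e)); [| easy].
    now apply in_map, in_edges.
Qed.

(** Itineraries are analysed through this description alone, in which the order of the updates no
    longer matters. By [edge_ext] a switch shares its endpoints with no other edge, so an updated
    entry belongs to a unique edge. *)
Lemma graph_spec d n A L u v x : switches n A L ->
  graph d n A L u v = Some x <->
  exists e, edge_wf n A e /\ u = code n (src e) /\ v = code n (dst e) /\
    weight d n L e x.
Proof.
  intros HL; unfold graph, weight.
  destruct (apply_all_spec (map (set_weight n (final_weight d n)) L)
    (initial_graph d n A) u v) as [(z & Hz & Ez & ->) | [Hn ->]].
  - apply in_map_iff in Hz as (e & <- & He); destruct (HL _ He) as [We Se].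
    inversion Ez; subst; simpl; split.
    + intros [= <-]; exists e; auto 10.
    + intros (e' & He' & Hs & Hd & Hx).
      assert (e' = e) as ->
        by (apply edge_ext; auto; apply (code_inj n); eauto using src_wf, dst_wf).
      destruct Hx as [[_ ->] | [Hx _]]; easy.
  - assert (Hne : forall e, edge_wf n A e -> u = code n (src e) ->
      v = code n (dst e) -> ~ In e L).
    { intros e He -> -> Hin.
      now apply (Hn (set_weight n (final_weight d n) e)); [apply in_map |]. }
    rewrite initial_graph_spec; split.
    + intros (e & He & Hu & Hv & ->); exists e; firstorder.
    + intros (e & He & Hu & Hv & [[Hin _] | [_ Hx]]);
        [now destruct (Hne e He Hu Hv) | exists e; auto].
Qed.

Lemma NoDup_mid_notin {T : Type} (L1 L2 : list T) (e : T) :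
  NoDup (L1 ++ e :: L2) -> ~ In e L1.
Proof.
  intros H Hin; apply (NoDup_remove_2 _ _ _ H), in_or_app; now left.
Qed.

(** [L1] holds the switches already performed, and the induction moves the head of [L2] to its end.
    Absence of duplicates means that the head still has its initial weight, from which the step to
    the final weight goes in direction [d]. *)
Lemma legal_switches d n A w (L1 L2 : list (edge nat)) :
  6 * n < 2 ^ w -> NoDup (L1 ++ L2) -> switches n A (L1 ++ L2) ->
  legal_upds d (order n) w (graph d n A L1)
    (map (set_weight n (final_weight d n)) L2).
Proof.
  intros Hw; revert L1; induction L2 as [| e L2 IH]; intros L1 ND HL; [easy |].
  assert (He : edge_wf n A e /\ is_switch e)
    by (apply HL, in_or_app; right; now left).
  destruct He as [We Se].
  cbn [map legal_upds]; split.
  - unfold set_weight, legal_upd.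
    split; [eapply code_lt, src_wf, We |].
    split; [eapply code_lt, dst_wf, We |].
    split.
    { destruct e as [| k a i | k a i | |]; try easy; cbn [final_weight];
        destruct We as (Hk & Ha & Hi); pose proof (stage_weight n k a Hk Ha);
        destruct d; lia. }
    exists (initial_weight d n e); split.
    + apply graph_spec.
      * intros e' He'; apply HL, in_or_app; now left.
      * exists e; repeat split; auto; right; split; [| easy].
        now apply NoDup_mid_notin with L2.
    + destruct e as [| k a i | k a i | |]; try easy; cbn [final_weight initial_weight];
        destruct We as (Hk & Ha & Hi); pose proof (stage_weight n k a Hk Ha);
        destruct d; lia.
  - replace (L1 ++ e :: L2) with ((L1 ++ [e]) ++ L2) in ND, HL
      by now rewrite <- app_assoc.
    specialize (IH _ ND HL).
    replace (apply_upd _ _) with (graph d n A (L1 ++ [e])); [exact IH |].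
    unfold graph; now rewrite map_app, apply_all_app.
Qed.

Lemma NoDup_keys n A f (L : list (edge nat)) :
  switches n A L -> NoDup L -> NoDup (map fst (map (set_weight n f) L)).
Proof.
  intros HL ND; rewrite map_map.
  induction ND as [| e L He ND IH]; simpl; constructor.
  - intros H; apply in_map_iff in H as (e' & E & He').
    inversion E as [[Hs Hd]].
    destruct (HL e' (or_intror He')) as [We' Se'], (HL e (or_introl eq_refl)) as [We Se].
    apply He; replace e with e'; [easy |].
    apply edge_ext; auto; apply (code_inj n); eauto using src_wf, dst_wf.
  - apply IH; intros e' He'; apply HL; now right.
Qed.

Lemma legal_reduction d once n A w (L : list (edge nat)) :
  6 * n < 2 ^ w -> NoDup L -> switches n A L ->
  legal_instance d once (order n) w (initial_graph d n A) (code n Source)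
    (code n Sink) (map (set_weight n (final_weight d n)) L).
Proof.
  intros Hw ND HL; unfold legal_instance.
  split; [apply code_lt; easy |].
  split; [apply code_lt; easy |].
  split; [simpl; lia |].
  split; [| split; [| split]].
  - intros i _; destruct (initial_graph d n A i i) as [x |] eqn:E; [| easy].
    apply initial_graph_spec in E as (e & We & Hs & Hd & _).
    assert (src e = dst e)
      by (apply (code_inj n); eauto using src_wf, dst_wf; congruence).
    destruct e; simpl in *; easy.
  - intros i j x _ _ E; apply initial_graph_spec in E as (e & We & _ & _ & ->).
    destruct e as [i0 | k a i0 | k a i0 | k i0 j0 | i0]; cbn -[Nat.mul] in *;
      try lia.
    + destruct d; lia.
    + destruct We as (Hk & Ha & Hi); pose proof (stage_weight n k a Hk Ha); lia.
    + destruct We as (Hk & Ha & Hi & _).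
      assert (Hk4 : k < 4) by lia.
      pose proof (stage_weight n k i0 Hk4 Ha); lia.
  - apply (legal_switches d n A w []); auto.
  - intros _; now apply NoDup_keys with A.
Qed.

(** * Schedule *)

Definition somes {T : Type} (l : list (option T)) : list T :=
  flat_map (fun o => match o with Some e => [e] | None => [] end) l.

Lemma somes_app {T : Type} (l l' : list (option T)) :
  somes (l ++ l') = somes l ++ somes l'.
Proof. apply flat_map_app. Qed.

Lemma in_somes {T : Type} (l : list (option T)) (e : T) :
  In e (somes l) <-> In (Some e) l.
Proof.
  unfold somes; rewrite in_flat_map; split.
  - intros ([x |] & Hx & H); simpl in H; [| easy].
    destruct H as [<- | []]; easy.
  - intros H; exists (Some e); simpl; auto.
Qed.

(** [None] stands for an acceptance test. *)
Definition filter_on {T : Type} (a i : T) : list (option (edge T)) :=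
  [Some (On 1 a i); Some (On 2 a i)].

Definition filter_off {T : Type} (a i : T) : list (option (edge T)) :=
  [Some (Off 1 a i); Some (Off 2 a i)].

Definition gate_on {T : Type} (a i : T) : list (option (edge T)) :=
  [Some (On 0 a i); Some (On 3 a i)].

Definition test_gate_off {T : Type} (a i : T) : list (option (edge T)) :=
  [None; Some (Off 0 a i); Some (Off 3 a i)].

Definition opening (A : nat -> nat -> bool) (a i : nat) : list (option (edge nat)) :=
  if A a i then filter_on a i else [].

Definition gate (A : nat -> nat -> bool) (a i : nat) : list (option (edge nat)) :=
  if A a i then gate_on a i else [].

Definition query (A : nat -> nat -> bool) (a i : nat) : list (option (edge nat)) :=
  gate A a i ++ test_gate_off a i.

(** Switching on depends on adjacency, switching off does not. An [Off k a i] left usable could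
    follow an [On] of a later phase through the same middle vertex, because the weight of the latter
    is smaller. *)
Definition phase (n : nat) (A : nat -> nat -> bool) (a : nat)
    : list (option (edge nat)) :=
  flat_map (opening A a) (seq 0 n) ++ flat_map (query A a) (seq 0 n) ++
  flat_map (filter_off a) (seq 0 n).

Definition schedule (n : nat) (A : nat -> nat -> bool) : list (option (edge nat)) :=
  flat_map (phase n A) (seq 0 n).

(** The prefix of [schedule] that precedes the acceptance test for the pair [(a, b)]; see
    [schedule_queries]. *)
Definition past (n : nat) (A : nat -> nat -> bool) (a b : nat)
    : list (option (edge nat)) :=
  flat_map (phase n A) (seq 0 a) ++ flat_map (opening A a) (seq 0 n) ++
  flat_map (query A a) (seq 0 b) ++ gate A a b.

Lemma in_opening A a i e : In (Some e) (opening A a i) <->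
  A a i = true /\ (e = On 1 a i \/ e = On 2 a i).
Proof.
  unfold opening; destruct (A a i); simpl; intuition congruence.
Qed.

Lemma in_gate A a i e : In (Some e) (gate A a i) <->
  A a i = true /\ (e = On 0 a i \/ e = On 3 a i).
Proof.
  unfold gate; destruct (A a i); simpl; intuition congruence.
Qed.

Lemma in_query A a i e : In (Some e) (query A a i) <->
  A a i = true /\ (e = On 0 a i \/ e = On 3 a i) \/ e = Off 0 a i \/ e = Off 3 a i.
Proof.
  unfold query; rewrite in_app_iff, in_gate; simpl; intuition congruence.
Qed.

Lemma in_filter_off a i e : In (Some e) (@filter_off nat a i) <->
  e = Off 1 a i \/ e = Off 2 a i.
Proof. simpl; intuition congruence. Qed.

Lemma in_upto {T : Type} (f : nat -> list T) (m : nat) (x : T) :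
  In x (flat_map f (seq 0 m)) <-> exists i, i < m /\ In x (f i).
Proof.
  rewrite in_flat_map; split; intros (i & Hi & H); exists i; split; auto;
    [apply in_seq in Hi; lia | apply in_seq; lia].
Qed.

Definition gated (k : nat) : Prop := k = 0 \/ k = 3.

Lemma in_phase n A a e : In (Some e) (phase n A a) <->
  exists i, i < n /\
    (A a i = true /\ (exists k, k < 4 /\ e = On k a i) \/ exists k, k < 4 /\ e = Off k a i).
Proof.
  unfold phase; rewrite !in_app_iff, !in_upto; split.
  - intros [(i & Hi & H) | [(i & Hi & H) | (i & Hi & H)]]; exists i; split; auto.
    + apply in_opening in H as [HA [-> | ->]]; left; split; auto;
        eexists; (split; [| reflexivity]); lia.
    + apply in_query in H as [[HA [-> | ->]] | [-> | ->]];
        [left; split; auto | left; split; auto | right | right];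
        eexists; (split; [| reflexivity]); lia.
    + apply in_filter_off in H as [-> | ->]; right; eexists; (split; [| reflexivity]); lia.
  - intros (i & Hi & [(HA & k & Hk & ->) | (k & Hk & ->)]);
      apply k_cases in Hk; destruct Hk as [-> | [-> | [-> | ->]]].
    1,4,5,8: right; left; exists i; split; auto; apply in_query; tauto.
    1,2: left; exists i; split; auto; apply in_opening; tauto.
    1,2: right; right; exists i; split; auto; apply in_filter_off; tauto.
Qed.

Lemma in_past n A a b e : In (Some e) (past n A a b) <->
  (exists a', a' < a /\ In (Some e) (phase n A a')) \/
  (exists i, i < n /\ In (Some e) (opening A a i)) \/
  (exists i, i < b /\ In (Some e) (query A a i)) \/
  In (Some e) (gate A a b).
Proof. unfold past; now rewrite !in_app_iff, !in_upto. Qed.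

(** One half of the proof that an open passage belongs to the current phase: what is on was set no
    later than [(a, b)], where the second component counts only in gated stages. *)
Lemma past_on n A a b k a' i : b < n -> In (Some (On k a' i)) (past n A a b) ->
  A a' i = true /\ a' <= a /\ (a' = a -> gated k -> i <= b).
Proof.
  intros Hb H; apply in_past in H as [(a0 & Ha0 & H) | [(i0 & Hi0 & H) | [(i0 & Hi0 & H) | H]]].
  - apply in_phase in H as (i0 & Hi0 & [(HA & k0 & Hk0 & E) | (k0 & Hk0 & E)]);
      inversion E; subst; repeat split; auto; lia.
  - apply in_opening in H as [HA [E | E]]; inversion E; subst; repeat split; auto;
      unfold gated; lia.
  - apply in_query in H as [[HA [E | E]] | [E | E]]; inversion E; subst; repeat split;
      auto; lia.
  - apply in_gate in H as [HA [E | E]]; inversion E; subst; repeat split; auto; lia.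
Qed.

(** The opposite half: every passage of an earlier phase, and every gated passage of an earlier pair
    in phase [a], has been switched off. *)
Lemma past_off n A a b k a' i : k < 4 -> i < n ->
  ~ In (Some (Off k a' i)) (past n A a b) ->
  a <= a' /\ (a' = a -> gated k -> b <= i).
Proof.
  intros Hk Hi H; rewrite in_past in H; split.
  - destruct (Nat.le_gt_cases a a') as [| Hlt]; [easy |].
    destruct H; left; exists a'; split; [easy |].
    apply in_phase; exists i; split; [easy |]; right; eauto.
  - intros -> Hg; destruct (Nat.le_gt_cases b i) as [| Hlt]; [easy |].
    destruct H; right; right; left; exists i; split; [easy |].
    apply in_query; right; destruct Hg as [-> | ->]; auto.
Qed.

Lemma past_current n A a b k i : k < 4 -> i < n -> (gated k -> i = b) ->
  (A a i = true -> In (Some (On k a i)) (past n A a b)) /\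
  ~ In (Some (Off k a i)) (past n A a b).
Proof.
  intros Hk Hi Hg; split.
  - intros HA; apply in_past; right.
    apply k_cases in Hk; destruct Hk as [-> | [-> | [-> | ->]]].
    + rewrite Hg in * by now left. right; right; apply in_gate; auto.
    + left; exists i; split; auto; apply in_opening; auto.
    + left; exists i; split; auto; apply in_opening; auto.
    + rewrite Hg in * by now right. right; right; apply in_gate; auto.
  - intros H; apply in_past in H as [(a0 & Ha0 & H) | [(i0 & Hi0 & H) | [(i0 & Hi0 & H) | H]]].
    + apply in_phase in H as (i0 & Hi0 & [(HA & k0 & Hk0 & E) | (k0 & Hk0 & E)]);
      inversion E; subst; lia.
    + apply in_opening in H as [HA [E | E]]; inversion E.
    + apply in_query in H as [[HA [E | E]] | [E | E]]; inversion E; subst;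
        unfold gated in Hg; lia.
    + apply in_gate in H as [HA [E | E]]; inversion E.
Qed.

Lemma app_eq_app_cons {T : Type} (p q l1 l2 : list T) (x : T) :
  p ++ q = l1 ++ x :: l2 ->
  (exists m, p = l1 ++ x :: m) \/ (exists m, q = m ++ x :: l2 /\ l1 = p ++ m).
Proof.
  revert l1; induction p as [| y p IH]; intros l1 E; simpl in *.
  - right; exists l1; auto.
  - destruct l1 as [| z l1]; simpl in E; inversion E; subst.
    + left; exists p; auto.
    + destruct (IH l1) as [(m & ->) | (m & -> & ->)]; auto.
      * left; now exists m.
      * right; now exists m.
Qed.

Lemma flat_map_upto_split {T : Type} (f : nat -> list T) (m : nat) (l1 l2 : list T)
    (x : T) :
  flat_map f (seq 0 m) = l1 ++ x :: l2 ->
  exists i m1 m2, i < m /\ f i = m1 ++ x :: m2 /\ l1 = flat_map f (seq 0 i) ++ m1.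
Proof.
  revert l1 l2; induction m as [| m IH]; intros l1 l2 E; [now destruct l1 |].
  rewrite seq_S, flat_map_app in E; simpl in E; rewrite app_nil_r in E.
  destruct (app_eq_app_cons _ _ _ _ _ E) as [(m' & E') | (m' & E' & ->)].
  - destruct (IH _ _ E') as (i & m1 & m2 & Hi & Ei & ->).
    exists i, m1, m2; auto.
  - exists m, m', l2; auto.
Qed.

Lemma flat_map_upto_at {T : Type} (f : nat -> list T) (m i : nat) : i < m ->
  flat_map f (seq 0 m) =
  flat_map f (seq 0 i) ++ f i ++ flat_map f (seq (S i) (m - S i)).
Proof.
  intros Hi; replace m with (i + S (m - S i)) at 1 by lia.
  rewrite seq_app, flat_map_app; reflexivity.
Qed.

(** Only [test_gate_off] contains [None]. Locating an occurrence from the outside in therefore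
    selects a phase [a], the middle part of that phase, and one [query A a b]. *)
Lemma schedule_queries (n : nat) (A : nat -> nat -> bool) (l1 : list (option (edge nat))) :
  (exists l2, schedule n A = l1 ++ None :: l2) <->
  exists a b, a < n /\ b < n /\ l1 = past n A a b.
Proof.
  assert (no_none : forall (f : nat -> list (option (edge nat))) m l1 l2,
    (forall i, ~ In None (f i)) -> flat_map f (seq 0 m) <> l1 ++ None :: l2).
  { intros f m p q Hf E.
    assert (H : In None (flat_map f (seq 0 m)))
      by (rewrite E; apply in_or_app; right; now left).
    apply in_upto in H as (i & _ & H); now apply Hf in H. }
  assert (no_opening : forall a i, ~ In None (opening A a i))
    by (intros a i; unfold opening; destruct (A a i); simpl; intuition congruence).
  split.
  - intros (l2 & E); unfold schedule in E.
    apply flat_map_upto_split in E as (a & m1 & m2 & Ha & E & ->).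
    unfold phase in E.
    apply app_eq_app_cons in E as [(m & E) | (m & E & ->)];
      [now apply no_none in E |].
    apply app_eq_app_cons in E as [(m' & E) | (m' & E & ->)].
    2: { apply no_none in E; [easy | intros i; simpl; intuition congruence]. }
    apply flat_map_upto_split in E as (b & p1 & p2 & Hb & E & ->).
    exists a, b; repeat split; auto; unfold past; do 3 f_equal.
    unfold query in E.
    apply app_eq_app_cons in E as [(q & E) | (q & E & ->)].
    + assert (H : In None (gate A a b))
        by (rewrite E; apply in_or_app; right; now left).
      unfold gate in H; destruct (A a b); simpl in H; intuition congruence.
    (* A nonempty [q] would place the test among the two [Off] entries that follow it. *)
    + destruct q as [| o q]; [now rewrite app_nil_r |].
      inversion E as [[E1 E2]].
      assert (H : In None [Some (Off 0 a b); Some (Off 3 a b)])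
        by (rewrite E2; apply in_or_app; right; now left).
      simpl in H; intuition congruence.
  - intros (a & b & Ha & Hb & ->); unfold schedule.
    rewrite (flat_map_upto_at _ n a Ha).
    unfold phase at 2; rewrite (flat_map_upto_at (query A a) n b Hb).
    unfold query at 2, past.
    eexists; rewrite <- !app_assoc; simpl; reflexivity.
Qed.

Lemma NoDup_flat_map_upto {T : Type} (f : nat -> list T) (m : nat) :
  (forall i, NoDup (f i)) -> (forall i j x, In x (f i) -> In x (f j) -> i = j) ->
  NoDup (flat_map f (seq 0 m)).
Proof.
  intros Hn Hd; induction m as [| m IH]; [constructor |].
  rewrite seq_S, flat_map_app; simpl; rewrite app_nil_r.
  apply NoDup_app; auto.
  intros x Hx Hm; apply in_upto in Hx as (i & Hi & Hx).
  specialize (Hd _ _ _ Hx Hm); lia.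
Qed.

Lemma somes_flat_map {T : Type} (f : nat -> list (option T)) (l : list nat) :
  somes (flat_map f l) = flat_map (fun i => somes (f i)) l.
Proof. induction l; simpl; [easy |]; now rewrite somes_app, IHl. Qed.

Ltac solve_NoDup :=
  repeat (constructor; [simpl; intuition congruence |]); constructor.

(** Each edge is modified at most once. Phase, vertex and stage are recorded in the switch, and the
    three parts of a phase differ in stage or in the kind of switch. *)
Lemma schedule_NoDup n A : NoDup (somes (schedule n A)).
Proof.
  unfold schedule; rewrite somes_flat_map; apply NoDup_flat_map_upto.
  - intros a; unfold phase; rewrite !somes_app, !somes_flat_map.
    apply NoDup_app; [| apply NoDup_app |].
    + apply NoDup_flat_map_upto.
      * intros i; unfold opening; destruct (A a i); simpl; solve_NoDup.
      * intros i j x Hi Hj; apply in_somes, in_opening in Hi, Hj.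
        destruct Hi as [_ [-> | ->]], Hj as [_ [E | E]]; congruence.
    + apply NoDup_flat_map_upto.
      * intros i; unfold query, gate; destruct (A a i); simpl; solve_NoDup.
      * intros i j x Hi Hj; apply in_somes, in_query in Hi, Hj.
        destruct Hi as [[_ [-> | ->]] | [-> | ->]], Hj as [[_ [E | E]] | [E | E]];
          congruence.
    + apply NoDup_flat_map_upto.
      * intros i; simpl; solve_NoDup.
      * intros i j x Hi Hj; apply in_somes, in_filter_off in Hi, Hj.
        destruct Hi as [-> | ->], Hj as [E | E]; congruence.
    + intros x Hx Hy; apply in_upto in Hx as (i & _ & Hi), Hy as (j & _ & Hj).
      apply in_somes, in_query in Hi; apply in_somes, in_filter_off in Hj.
      destruct Hi as [[_ [-> | ->]] | [-> | ->]], Hj as [E | E]; congruence.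
    + intros x Hx Hy; apply in_upto in Hx as (i & _ & Hi).
      apply in_somes, in_opening in Hi.
      apply in_app_or in Hy as [Hy | Hy]; apply in_upto in Hy as (j & _ & Hj);
        apply in_somes in Hj; [apply in_query in Hj | apply in_filter_off in Hj];
        destruct Hi as [_ [-> | ->]]; intuition congruence.
  - intros a a' x Hx Hx'; apply in_somes, in_phase in Hx, Hx'.
    destruct Hx as (i & _ & [(_ & k & _ & ->) | (k & _ & ->)]),
      Hx' as (i' & _ & [(_ & k' & _ & E) | (k' & _ & E)]); congruence.
Qed.

Lemma schedule_switches n A : switches n A (somes (schedule n A)).
Proof.
  intros e He; apply in_somes in He; unfold schedule in He.
  apply in_upto in He as (a & Ha & He).
  apply in_phase in He as (i & Hi & [(_ & k & Hk & ->) | (k & Hk & ->)]); simpl; auto.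
Qed.

Lemma past_switches n A a b : a < n -> b < n -> switches n A (somes (past n A a b)).
Proof.
  intros Ha Hb e He; apply schedule_switches.
  destruct (proj2 (schedule_queries n A (past n A a b))) as (l2 & ->); [eauto |].
  rewrite somes_app; apply in_or_app; now left.
Qed.

Lemma flat_map_length_le {T : Type} (f : nat -> list T) (c : nat) (l : list nat) :
  (forall i, length (f i) <= c) -> length (flat_map f l) <= length l * c.
Proof.
  intros Hf; induction l as [| i l IH]; simpl; [lia |].
  rewrite length_app; specialize (Hf i); lia.
Qed.

(** Per pair: two filters on, then two gates on, one test and two gates off, and finally two filters
    off. *)
Lemma schedule_length n A : length (schedule n A) <= 9 * (n * n).
Proof.
  unfold schedule.
  rewrite (flat_map_length_le _ (n * 9)); [rewrite length_seq; lia |].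
  intros a; unfold phase; rewrite !length_app.
  assert (H1 : forall i, length (opening A a i) <= 2)
    by (intros i; unfold opening; destruct (A a i); simpl; lia).
  assert (H2 : forall i, length (query A a i) <= 5)
    by (intros i; unfold query, gate; destruct (A a i); simpl; lia).
  assert (H3 : forall i, length (filter_off a i) <= 2) by (intros i; simpl; lia).
  apply flat_map_length_le with (l := seq 0 n) in H1, H2, H3.
  rewrite length_seq in *; lia.
Qed.

(** * Itineraries *)

Definition accepts (N : nat) (G : wgraph) (s t bound : nat) : Prop :=
  exists p, valid_itinerary N G s p t /\ arrival p <= bound.

(** Describes the rest of an itinerary whose previous edge had weight [x]. Putting [x] in front of
    the weights expresses monotonicity at the joint, and gives the arrival value even if no edge
    remains. *)
Definition continues (N : nat) (G : wgraph) (t bound u x : nat) : Prop :=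
  exists p, walk N G u p t /\ Sorted le (x :: map snd p) /\
    last (x :: map snd p) 0 <= bound.

(** The previous weight [0] imposes no constraint, and it equals the default value in [arrival], so
    the bounds agree for the empty walk too. *)
Lemma accepts_continues N G s t bound :
  accepts N G s t bound <-> continues N G t bound s 0.
Proof.
  assert (E : forall p : list (nat * nat), last (0 :: map snd p) 0 = arrival p)
    by (intros [| z p]; reflexivity).
  split; intros (p & H); exists p; rewrite E in *.
  - destruct H as [[Hw Hs] Ha]; repeat split; auto.
    constructor; auto; destruct p; constructor; lia.
  - destruct H as (Hw & Hs & Ha); repeat split; auto.
    now inversion Hs.
Qed.

Lemma sorted_le_last (l : list nat) (x : nat) :
  Sorted le (x :: l) -> x <= last (x :: l) 0.
Proof.
  revert x; induction l as [| y l IH]; intros x H; [simpl; lia |].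
  inversion H as [| ? ? H1 H2]; subst; inversion H2; subst.
  apply IH in H1; change (last (x :: y :: l) 0) with (last (y :: l) 0); lia.
Qed.

(** * Correctness of a single acceptance test *)

Section Correctness.

Variables (d : direction) (n : nat) (A : nat -> nat -> bool).

Let sink := code n Sink.

(** The bound on [y] holds since the last weight dominates all earlier ones; it is what keeps
    accepted itineraries off edges of weight [6 * n]. *)
Lemma continues_step L (u : node) (x : nat) :
  switches n A L -> node_wf n u -> u <> Sink ->
  continues (order n) (graph d n A L) sink (5 * n) (code n u) x ->
  exists e y, edge_wf n A e /\ src e = u /\ weight d n L e y /\
    x <= y <= 5 * n /\
    continues (order n) (graph d n A L) sink (5 * n) (code n (dst e)) y.
Proof.
  intros HL Hu Ht (p & Hw & Hs & Hl); destruct p as [| [v y] p].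
  - simpl in Hw; destruct Ht; now apply (code_inj n).
  - destruct Hw as (Hv & HG & Hw); cbn [map snd] in Hs, Hl.
    inversion Hs as [| ? ? Hs' Hxy]; subst; inversion Hxy; subst.
    change (last (y :: map snd p) 0 <= 5 * n) in Hl.
    pose proof (sorted_le_last _ _ Hs') as Hy.
    apply graph_spec in HG as (e & We & Hsrc & -> & Hwt); [| easy].
    exists e, y; repeat split; auto; try lia.
    + apply (code_inj n); auto; eapply src_wf, We.
    + exists p; auto.
Qed.

Lemma continues_cons L (e : edge nat) (x y : nat) :
  switches n A L -> edge_wf n A e -> weight d n L e y -> x <= y ->
  continues (order n) (graph d n A L) sink (5 * n) (code n (dst e)) y ->
  continues (order n) (graph d n A L) sink (5 * n) (code n (src e)) x.
Proof.
  intros HL We Hwt Hxy (p & Hw & Hs & Hl).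
  exists ((code n (dst e), y) :: p); split; [| split].
  - split; [eapply code_lt, dst_wf, We |]; split; [| easy].
    apply graph_spec; [easy | exists e; auto].
  - cbn [map snd]; constructor; [easy | now constructor].
  - exact Hl.
Qed.

Lemma weight_static L e y : switches n A L -> ~ is_switch e ->
  weight d n L e y <-> y = initial_weight d n e.
Proof.
  intros HL He; unfold weight; split.
  - intros [[Hin _] | [_ Hy]]; [| easy].
    now apply HL in Hin as [_ Hin].
  - intros ->; right; split; [| easy].
    intros Hin; now apply HL in Hin as [_ Hin].
Qed.

Variables (a b : nat) (Ha : a < n) (Hb : b < n).

Let L := somes (past n A a b).
Let to_sink u x :=
  continues (order n) (graph d n A L) sink (5 * n) (code n u) x.

Let HL : switches n A L := past_switches n A a b Ha Hb.

(** The switch entered was set in a phase [a0 <= a], the switch left is to be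
    reset in a phase [a' >= a], and the weights force [a' <= a0].  So both belong
    to phase [a], and then the middle vertex [a + i] determines [i]. *)
Lemma stage_sound k i x : k < 4 -> i < n -> (k + 1) * n <= x ->
  to_sink (In_ k i) x ->
  A a i = true /\ (gated k -> i = b) /\ exists y, to_sink (Out k i) y.
Proof.
  intros Hk Hi Hx H.
  apply continues_step in H as (e & y & We & Hs & Hwt & Hxy & H); [| easy .. ].
  destruct e as [| k' a0 i0 | | |]; inversion Hs; subst k' i0; cbn [dst] in H.
  destruct We as (_ & Ha0 & _).
  pose proof (stage_weight n k a0 Hk Ha0) as B0.
  assert (H1 : In (On k a0 i) L /\ y = (k + 2) * n - a0).
  { destruct Hwt as [[Hin ->] | [_ ->]]; [now split |].
    exfalso; simpl in Hxy; destruct d; lia. }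
  destruct H1 as [H1 ->].
  apply in_somes, past_on in H1 as (HA & Hle & Hgate); [| easy].
  apply continues_step in H as (e & y' & We & Hs' & Hwt' & Hxy' & H);
    [| easy | simpl; lia | easy].
  destruct e as [| | k' a1 i1 | |]; inversion Hs' as [[Ek Ej]]; subst k'; cbn [dst] in H.
  destruct We as (_ & Ha1 & Hi1).
  pose proof (stage_weight n k a1 Hk Ha1) as B1.
  assert (H1 : ~ In (Off k a1 i1) L /\ y' = (k + 2) * n - a1).
  { destruct Hwt' as [[_ ->] | [Hin ->]]; [| now split].
    exfalso; simpl in Hxy'; destruct d; lia. }
  destruct H1 as [H1 ->].
  assert (H2 : ~ In (Some (Off k a1 i1)) (past n A a b))
    by (intros X; now apply H1, in_somes).
  apply past_off in H2 as (Hge & Hgate'); [| easy | easy].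
  assert (a0 = a /\ a1 = a) as [-> ->] by lia.
  assert (i1 = i) as -> by lia.
  split; [easy |]; split; [| eauto].
  intros Hg; specialize (Hgate eq_refl Hg); specialize (Hgate' eq_refl Hg); lia.
Qed.

(** Both halves of the current passage carry the weight [(k + 2) * n - a], which fits between the
    entry weight and the link that follows. *)
Lemma stage_complete k i : k < 4 -> i < n -> A a i = true -> (gated k -> i = b) ->
  to_sink (Out k i) ((k + 2) * n) -> to_sink (In_ k i) ((k + 1) * n).
Proof.
  intros Hk Hi HA Hg (p & Hw & Hs & Hl).
  destruct (past_current n A a b k i Hk Hi Hg) as [H1 H2].
  pose proof (stage_weight n k a Hk Ha) as B.
  apply (continues_cons L (On k a i) _ ((k + 2) * n - a)); [easy | easy | | lia |].
  { left; split; [apply in_somes; auto | easy]. }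
  apply (continues_cons L (Off k a i) _ ((k + 2) * n - a)); [easy | easy | | lia |].
  { right; split; [intros X; now apply H2, in_somes | easy]. }
  exists p; split; [easy |].
  (* The walk from [Out k i] has a first edge, of weight at least [(k + 2) * n]; replacing the
     previous weight by a smaller one thus preserves sortedness and the last value. *)
  destruct p as [| [v y] p]; [exfalso |].
  - apply (code_inj n (Out k i) Sink) in Hw; simpl; easy.
  - cbn [map snd] in *; split; [| exact Hl].
    inversion Hs as [| ? ? Hs' Hh]; subst; inversion Hh; subst.
    constructor; [easy | constructor; lia].
Qed.

Lemma link_step k i x : k < 3 -> i < n -> to_sink (Out k i) x ->
  exists j, j < n /\ A i j = true /\ to_sink (In_ (S k) j) ((S k + 1) * n).
Proof.
  intros Hk Hi H.
  apply continues_step in H as (e & y & We & Hs & Hwt & Hxy & H);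
    [| easy | simpl; lia | easy].
  destruct e as [| | | k' i0 j |]; inversion Hs; subst; [| lia].
  apply weight_static in Hwt; [| easy | easy]; subst y.
  destruct We as (_ & _ & Hj & HA); exists j; repeat split; auto.
  (* The weight of a link is the entry weight of the next stage. *)
  replace (S k + 1) with (k + 2) by lia; exact H.
Qed.

Lemma link_cons k i j : k < 3 -> i < n -> j < n -> A i j = true ->
  to_sink (In_ (S k) j) ((S k + 1) * n) -> to_sink (Out k i) ((k + 2) * n).
Proof.
  intros Hk Hi Hj HA H.
  apply (continues_cons L (Link k i j) _ ((k + 2) * n)); [easy | easy | | lia |].
  - now apply weight_static.
  - replace (k + 2) with (S k + 1) by lia; exact H.
Qed.

(** The walk is followed stage by stage. Each stage certifies adjacency to [a], each link an edge of
    the input graph, and the gates in stages 0 and 3 force the first and last vertex to be [b]. *)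
Lemma query_correct :
  accepts (order n) (graph d n A L) (code n Source) sink (5 * n) <->
  exists c c', c < n /\ c' < n /\ A a b = true /\ A a c = true /\ A a c' = true /\
    A b c = true /\ A c c' = true /\ A c' b = true.
Proof.
  rewrite accepts_continues; split.
  - intros H.
    apply (continues_step L Source) in H as (e & y & We & Hs & Hwt & Hxy & H);
      [| easy | easy | easy].
    destruct e as [b0 | | | |]; inversion Hs.
    apply weight_static in Hwt; [| easy | easy]; subst y; cbn [dst edge_wf initial_weight] in H, We.
    apply stage_sound in H as (Hab & Hg & y & H); [| lia | easy | lia].
    assert (b0 = b) as -> by (apply Hg; now left).
    apply link_step in H as (c & Hc & Hbc & H); [| lia | easy].
    apply stage_sound in H as (Hac & _ & y1 & H); [| lia | easy | lia].
    apply link_step in H as (c' & Hc' & Hcc & H); [| lia | easy].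
    apply stage_sound in H as (Hac' & _ & y2 & H); [| lia | easy | lia].
    apply link_step in H as (b1 & Hb1 & Hcb & H); [| lia | easy].
    apply stage_sound in H as (_ & Hg3 & _); [| lia | easy | lia].
    assert (b1 = b) as -> by (apply Hg3; now right).
    exists c, c'; auto 10.
  - intros (c & c' & Hc & Hc' & Hab & Hac & Hac' & Hbc & Hcc & Hcb).
    apply (continues_cons L (Start b) _ n); [easy | easy | | lia |].
    { now apply weight_static. }
    (* The fifth occurrence is the previous weight: the edge [Start b] provides the entry weight of
       stage 0. *)
    replace n with ((0 + 1) * n) at 5 by lia.
    apply stage_complete; [lia | easy | easy | easy |].
    apply link_cons with c; [lia | easy | easy | easy |].
    apply stage_complete; [lia | easy | easy | now intros [|] |].
    apply link_cons with c'; [lia | easy | easy | easy |].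
    apply stage_complete; [lia | easy | easy | now intros [|] |].
    apply link_cons with b; [lia | easy | easy | easy |].
    apply stage_complete; [lia | easy | easy | easy |].
    apply (continues_cons L (Final b) _ (5 * n)); [easy | easy | | lia |].
    { now apply weight_static. }
    exists []; split; [reflexivity |]; split; [repeat constructor |].
    cbn [map last]; lia.
Qed.

End Correctness.

(** A successful test yields a triangle through [b] inside the neighbourhood of [a]. Symmetry
    converts between its closing edge from [c'] to [b] and the edge listed in [has_4clique]. *)
Lemma queries_decide (d : direction) (n : nat) (A : nat -> nat -> bool) :
  simple_graph n A ->
  (exists l1 l2, schedule n A = l1 ++ None :: l2 /\
    accepts (order n) (graph d n A (somes l1)) (code n Source) (code n Sink) (5 * n))
  <-> has_4clique n A.
Proof.
  intros HS.
  assert (sym : forall i j, i < n -> j < n -> A i j = A j i)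
    by (intros i j Hi Hj; now apply HS).
  split.
  - intros (l1 & l2 & E & H).
    destruct (proj1 (schedule_queries n A l1)) as (a & b & Ha & Hb & ->); [eauto |].
    apply query_correct in H as (c & c' & Hc & Hc' & Hab & Hac & Hac' & Hbc & Hcc & Hcb);
      [| easy | easy].
    rewrite sym in Hcb by easy; exists a, b, c, c'; auto 15.
  - intros (a & b & c & c' & Ha & Hb & Hc & Hc' & Hab & Hac & Hac' & Hbc & Hbc' & Hcc).
    destruct (proj2 (schedule_queries n A (past n A a b))) as (l2 & E); [eauto |].
    exists (past n A a b), l2; split; [easy |].
    apply query_correct; [easy | easy |].
    rewrite sym in Hbc' by easy; exists c, c'; auto 10.
Qed.

(** * The glue program *)

Definition edge_map {T T' : Type} (f : T -> T') (e : edge T) : edge T' :=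
  match e with
  | Start i => Start (f i)
  | On k a i => On k (f a) (f i)
  | Off k a i => Off k (f a) (f i)
  | Link k i j => Link k (f i) (f j)
  | Final i => Final (f i)
  end.

(** Register 0 holds [n], register 1 the order of the temporal graph, registers 2
    and 3 the loop counters. *)
Definition lin (q : nat) (e : exp) : exp := Bin Add (Bin Mul (Cst q) (Reg 0)) e.

Definition src_exp (e : edge exp) : exp :=
  match e with
  | Start i => lin 16 (Cst 0)
  | On k a i => lin (4 * k) i
  | Off k a i => lin (4 * k + 1) (Bin Add a i)
  | Link k i j => lin (4 * k + 3) i
  | Final i => lin 15 i
  end.

Definition dst_exp (e : edge exp) : exp :=
  match e with
  | Start i => lin 0 i
  | On k a i => lin (4 * k + 1) (Bin Add a i)
  | Off k a i => lin (4 * k + 3) i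
  | Link k i j => lin (4 * S k) j
  | Final i => lin 16 (Cst 1)
  end.

Definition initial_exp (d : direction) (e : edge exp) : exp :=
  match e with
  | Start i => lin 1 (Cst 0)
  | On k a i => match d with Incremental => Cst 0 | Decremental => lin 6 (Cst 0) end
  | Off k a i => Bin Sub (lin (k + 2) (Cst 0)) a
  | Link k i j => lin (k + 2) (Cst 0)
  | Final i => lin 5 (Cst 0)
  end.

Definition final_exp (d : direction) (e : edge exp) : exp :=
  match e with
  | On k a i => Bin Sub (lin (k + 2) (Cst 0)) a
  | Off k a i => match d with Incremental => lin 6 (Cst 0) | Decremental => Cst 0 end
  | _ => initial_exp d e
  end.

Definition glue_send (d : direction) (e : edge exp) : glue :=
  let p := Bin Add (Bin Mul (src_exp e) (Reg 1)) (dst_exp e) in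
  GSeq (GSend 0 p (Cst 1)) (GSend 1 p (initial_exp d e)).

Definition glue_step (d : direction) (o : option (edge exp)) : glue :=
  match o with
  | Some e =>
      GSeq (GArg 3 (src_exp e))
        (GSeq (GArg 4 (dst_exp e)) (GSeq (GArg 5 (final_exp d e)) GUpdate))
  | None => GAccept (lin 5 (Cst 0))
  end.

Fixpoint glue_list (l : list glue) : glue :=
  match l with
  | [] => GSkip
  | g :: l' => GSeq g (glue_list l')
  end.

Definition glue_for (r : nat) (g : glue) : glue :=
  GSeq (GAssign r (Cst 0))
    (GWhile (Bin Lt (Reg r) (Reg 0))
       (GSeq g (GAssign r (Bin Add (Reg r) (Cst 1))))).

Definition glue_if_edge (g : glue) : glue :=
  GIf (Arr 0 (Bin Add (Bin Mul (Reg 2) (Reg 0)) (Reg 3))) g GSkip.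

Definition glue_block (d : direction) : glue :=
  GSeq (glue_list (map (glue_send d) (spokes (Reg 2) (Reg 3))))
    (glue_if_edge (glue_list (map (glue_send d) (links (Reg 2) (Reg 3))))).

Definition glue_steps (d : direction) (l : list (option (edge exp))) : glue :=
  glue_list (map (glue_step d) l).

Definition glue_phase (d : direction) : glue :=
  GSeq (glue_for 3 (glue_if_edge (glue_steps d (filter_on (Reg 2) (Reg 3)))))
    (GSeq
       (glue_for 3
          (GSeq (glue_if_edge (glue_steps d (gate_on (Reg 2) (Reg 3))))
             (glue_steps d (test_gate_off (Reg 2) (Reg 3)))))
       (glue_for 3 (glue_steps d (filter_off (Reg 2) (Reg 3))))).

Definition reduction (d : direction) : glue :=
  GSeq (GAssign 1 (lin 16 (Cst 2)))
    (GSeq (GSeq (GArg 0 (Reg 1)) (GSeq (GArg 1 (lin 16 (Cst 0))) (GArg 2 (lin 16 (Cst 1)))))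
       (GSeq (glue_for 2 (glue_for 3 (glue_block d)))
          (GSeq GInit (glue_for 2 (glue_phase d))))).

Definition send_ops (d : direction) (n : nat) (e : edge nat) : list op :=
  let p := code n (src e) * order n + code n (dst e) in
  [OSend 0 p 1; OSend 1 p (initial_weight d n e)].

Definition step_ops (d : direction) (n : nat) (o : option (edge nat)) : list op :=
  match o with
  | Some e => [OArg 3 (code n (src e)); OArg 4 (code n (dst e));
               OArg 5 (final_weight d n e); OUpdate]
  | None => [OAccept (5 * n)]
  end.

Definition reduction_trace (d : direction) (n : nat) (A : nat -> nat -> bool) : list op :=
  [OArg 0 (order n); OArg 1 (code n Source); OArg 2 (code n Sink)] ++
  flat_map (send_ops d n) (edges n A) ++ [OInit] ++
  flat_map (step_ops d n) (schedule n A).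

Lemma flat_map_flat_map {T1 T2 T3 : Type} (f : T2 -> list T3) (g : T1 -> list T2)
    (l : list T1) :
  flat_map f (flat_map g l) = flat_map (fun x => flat_map f (g x)) l.
Proof. induction l; simpl; [easy |]; now rewrite flat_map_app, IHl. Qed.

Lemma flat_map_if {T1 T2 : Type} (f : T1 -> list T2) (c : bool) (l : list T1) :
  flat_map f (if c then l else []) = if c then flat_map f l else [].
Proof. now destruct c. Qed.

(** * Trace and running time of the glue program *)

Section Glue.

Variables (d : direction) (n w : nat) (A : nat -> nat -> bool).
Variable inp : nat -> nat -> nat.
(** Excludes overflow: the largest values are matrix positions, below the square of [16 * n + 2]. *)
Hypothesis Hfit : 256 * ((n + 1) * (n + 1)) <= 2 ^ w.
Hypothesis Hinp : forall a i, a < n -> i < n -> inp 0 (a * n + i) = Nat.b2n (A a i).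

Definition agree (r : nat) (rho rho' : nat -> nat) : Prop :=
  forall q, q < r -> rho' q = rho q.

(** Preserving the registers below [r] keeps [n], the order of the temporal graph and the counters
    of the enclosing loops intact. *)
Definition emits (r : nat) (g : glue) (rho : nat -> nat) (tr : list op) (m : nat)
  : Prop :=
  exists rho' k, gexec w inp g rho rho' tr k /\ k <= m /\ agree r rho rho'.

Lemma emits_weaken r r' g rho tr m m' :
  emits r' g rho tr m -> r <= r' -> m <= m' -> emits r g rho tr m'.
Proof.
  intros (rho' & k & E & Hk & Ag) Hr Hm; exists rho', k; repeat split;
    [easy | lia | intros q Hq; apply Ag; lia].
Qed.

Lemma emits_seq r g1 g2 rho tr1 tr2 m1 m2 :
  emits r g1 rho tr1 m1 ->
  (forall rho', agree r rho rho' -> emits r g2 rho' tr2 m2) ->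
  emits r (GSeq g1 g2) rho (tr1 ++ tr2) (m1 + m2).
Proof.
  intros (rho1 & k1 & E1 & Hk1 & Ag1) H2.
  destruct (H2 rho1 Ag1) as (rho2 & k2 & E2 & Hk2 & Ag2).
  exists rho2, (k1 + k2); split; [now apply gexec_seq with rho1 |].
  split; [lia |]; intros q Hq; rewrite Ag2, Ag1; auto.
Qed.

Lemma emits_list {T T' : Type} r (F : T -> glue) (h : T -> T') (f : T' -> list op) m
    (l : list T) rho :
  (forall x rho', In x l -> agree r rho rho' -> emits r (F x) rho' (f (h x)) m) ->
  emits r (glue_list (map F l)) rho (flat_map f (map h l)) (length l * m).
Proof.
  revert rho; induction l as [| x l IH]; intros rho H.
  - exists rho, 0; repeat split; [constructor | lia].
  - simpl; apply emits_seq.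
    + apply H; [now left | easy].
    + intros rho' Ag; apply IH; intros y rho'' Hy Ag'.
      apply H; [now right |]; intros q Hq; rewrite Ag', Ag; auto.
Qed.

Lemma eval_cst rho q : q <= 255 -> eval w (State rho inp) (Cst q) = q.
Proof. intros Hq; simpl; apply Nat.mod_small; lia. Qed.

Lemma eval_lin rho q e v : rho 0 = n -> q <= 19 -> v <= 2 * n + 2 ->
  eval w (State rho inp) e = v -> eval w (State rho inp) (lin q e) = q * n + v.
Proof.
  intros H0 Hq Hv He; unfold lin; cbn [eval eval_binop reg].
  rewrite H0, He, (Nat.mod_small q) by nia.
  assert (q * n <= 19 * n) by nia.
  rewrite (Nat.mod_small (q * n)) by nia.
  apply Nat.mod_small; nia.
Qed.

Lemma eval_add rho e1 e2 v1 v2 : v1 < n -> v2 < n ->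
  eval w (State rho inp) e1 = v1 -> eval w (State rho inp) e2 = v2 ->
  eval w (State rho inp) (Bin Add e1 e2) = v1 + v2.
Proof.
  intros H1 H2 E1 E2; cbn [eval eval_binop]; rewrite E1, E2.
  apply Nat.mod_small; nia.
Qed.

Lemma eval_sub rho e1 e2 v1 v2 : v1 <= 5 * n ->
  eval w (State rho inp) e1 = v1 -> eval w (State rho inp) e2 = v2 ->
  eval w (State rho inp) (Bin Sub e1 e2) = v1 - v2.
Proof.
  intros H1 E1 E2; cbn [eval eval_binop]; rewrite E1, E2.
  apply Nat.mod_small; nia.
Qed.

Ltac solve_eval :=
  repeat match goal with
  | |- eval _ _ (Cst _) = _ => apply eval_cst; lia
  | |- eval _ _ (lin ?q (Cst ?c)) = _ =>
      first [ apply (eval_lin _ q (Cst c) c)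
            | rewrite <- (Nat.add_0_r (_ * n)); apply (eval_lin _ q (Cst c) c) ];
      try lia
  | |- eval _ _ (lin _ _) = _ => apply eval_lin; try lia
  | |- eval _ _ (Bin Add _ _) = _ => apply eval_add; try lia
  | |- eval _ _ (Bin Sub _ _) = _ => apply eval_sub; try lia
  end; try reflexivity; try lia.

(** With all pairs adjacent, [edge_wf] reduces to the index ranges, which suffice for the
    arithmetic. *)
Let wf (e : edge nat) : Prop := edge_wf n (fun _ _ => true) e.

Lemma eval_src rho e : rho 0 = n ->
  wf (edge_map (eval w (State rho inp)) e) ->
  eval w (State rho inp) (src_exp e) =
  code n (src (edge_map (eval w (State rho inp)) e)).
Proof.
  intros H0; destruct e; cbn -[Nat.mul Nat.add lin eval]; intros We; solve_eval.
Qed.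

Lemma eval_dst rho e : rho 0 = n ->
  wf (edge_map (eval w (State rho inp)) e) ->
  eval w (State rho inp) (dst_exp e) =
  code n (dst (edge_map (eval w (State rho inp)) e)).
Proof.
  intros H0; destruct e; cbn -[Nat.mul Nat.add lin eval]; intros We; solve_eval.
Qed.

Lemma eval_initial rho e : rho 0 = n ->
  wf (edge_map (eval w (State rho inp)) e) ->
  eval w (State rho inp) (initial_exp d e) =
  initial_weight d n (edge_map (eval w (State rho inp)) e).
Proof.
  intros H0; destruct e as [| k a i | k a i | |]; try destruct d;
    cbn -[Nat.mul Nat.add Nat.sub lin eval]; intros We; solve_eval;
    (* What remains is the weight of [Start], computed as [1 * n + 0], and the nonlinear bound
       [(k + 2) * n <= 5 * n] for [Off], each in both directions. *)
    [rewrite (eval_lin _ 1 _ 0) by (try apply eval_cst; lia); lia .. | nia | nia].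
Qed.

Lemma eval_final rho e : rho 0 = n ->
  wf (edge_map (eval w (State rho inp)) e) ->
  eval w (State rho inp) (final_exp d e) =
  final_weight d n (edge_map (eval w (State rho inp)) e).
Proof.
  intros H0; destruct e as [| k a i | k a i | |]; try destruct d;
    cbn -[Nat.mul Nat.add Nat.sub lin eval]; intros We; solve_eval;
    [rewrite (eval_lin _ 1 _ 0) by (try apply eval_cst; lia); lia .. | nia | nia].
Qed.

Lemma emits_send r rho e : rho 0 = n -> rho 1 = order n ->
  wf (edge_map (eval w (State rho inp)) e) ->
  emits r (glue_send d e) rho
    (send_ops d n (edge_map (eval w (State rho inp)) e)) 2.
Proof.
  intros H0 H1 We; exists rho, 2; split; [| split; [lia | easy]].
  unfold glue_send, send_ops; cbv zeta.
  pose proof (code_lt n _ (src_wf _ _ _ We)) as Hs.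
  pose proof (code_lt n _ (dst_wf _ _ _ We)) as Hd.
  set (p := Bin Add _ _).
  assert (Hp : eval w (State rho inp) p =
    code n (src (edge_map (eval w (State rho inp)) e)) * order n +
    code n (dst (edge_map (eval w (State rho inp)) e))).
  { subst p; cbn [eval eval_binop reg]; rewrite eval_src, eval_dst, H1 by easy.
    unfold order in *; rewrite (Nat.mod_small (_ * _)) by nia.
    apply Nat.mod_small; nia. }
  pose proof (gexec_seq w inp _ _ rho rho rho _ _ _ _
    (gexec_send w inp 0 p (Cst 1) rho)
    (gexec_send w inp 1 p (initial_exp d e) rho)) as G.
  rewrite Hp, eval_cst, eval_initial in G by (easy || lia); exact G.
Qed.

Lemma emits_step r rho o : rho 0 = n ->
  (forall e, o = Some e -> wf (edge_map (eval w (State rho inp)) e)) ->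
  emits r (glue_step d o) rho
    (step_ops d n (option_map (edge_map (eval w (State rho inp))) o)) 3.
Proof.
  intros H0 We; destruct o as [e |]; cbn [glue_step step_ops option_map].
  - specialize (We e eq_refl); exists rho, 3; split; [| split; [lia | easy]].
    rewrite <- eval_src, <- eval_dst, <- eval_final by easy.
    exact (gexec_seq w inp _ _ rho rho rho _ _ _ _ (gexec_arg w inp 3 _ rho)
      (gexec_seq w inp _ _ rho rho rho _ _ _ _ (gexec_arg w inp 4 _ rho)
        (gexec_seq w inp _ _ rho rho rho _ _ _ _ (gexec_arg w inp 5 _ rho)
          (gexec_update w inp rho)))).
  - exists rho, 0; split; [| split; [lia | easy]].
    replace (5 * n) with (eval w (State rho inp) (lin 5 (Cst 0))) by solve_eval.
    constructor.
Qed.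

Lemma emits_steps r rho l : 1 <= r -> rho 0 = n ->
  (forall rho' e, agree r rho rho' -> In (Some e) l ->
    edge_map (eval w (State rho' inp)) e = edge_map (eval w (State rho inp)) e /\
    wf (edge_map (eval w (State rho inp)) e)) ->
  emits r (glue_steps d l) rho
    (flat_map (step_ops d n) (map (option_map (edge_map (eval w (State rho inp)))) l))
    (length l * 3).
Proof.
  intros Hr H0 Hl; unfold glue_steps; apply emits_list.
  intros o rho' Ho Ag.
  replace (option_map (edge_map (eval w (State rho inp))) o)
    with (option_map (edge_map (eval w (State rho' inp))) o).
  - apply emits_step; [rewrite Ag by lia; easy |].
    intros e ->; destruct (Hl rho' e Ag Ho) as [-> We]; easy.
  - destruct o as [e |]; [| easy]; simpl; f_equal; now apply Hl.
Qed.

Lemma emits_if_edge r g rho a i tr m :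
  rho 0 = n -> rho 2 = a -> rho 3 = i -> a < n -> i < n ->
  emits r g rho tr m ->
  emits r (glue_if_edge g) rho (if A a i then tr else []) (S m).
Proof.
  intros H0 H2 H3 Ha Hi (rho' & k & E & Hk & Ag).
  assert (Hp : eval w (State rho inp)
    (Arr 0 (Bin Add (Bin Mul (Reg 2) (Reg 0)) (Reg 3))) = Nat.b2n (A a i)).
  { cbn [eval eval_binop reg arr]; rewrite H0, H2, H3.
    rewrite (Nat.mod_small (a * n)) by nia.
    rewrite Nat.mod_small by nia; now apply Hinp. }
  unfold glue_if_edge; destruct (A a i).
  - exists rho', (S k); split; [| split; [lia | easy]].
    apply gexec_if_true; [now rewrite Hp | easy].
  - exists rho, 1; split; [| split; [lia | easy]].
    apply gexec_if_false; [now rewrite Hp | constructor].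
Qed.

(** An iteration adds a test and an increment to its body; initialisation and the failing test
    account for the final 2. The body must preserve the counter itself, hence [S r]. *)
Lemma emits_for r g rho f m : 0 < r -> rho 0 = n ->
  (forall i rho', i < n -> agree r rho rho' -> rho' r = i ->
    emits (S r) g rho' (f i) m) ->
  emits r (glue_for r g) rho (flat_map f (seq 0 n)) (n * (m + 2) + 2).
Proof.
  intros Hr H0 Hg.
  assert (loop : forall j i rho', i + j = n -> agree r rho rho' -> rho' r = i ->
    exists rho'' k,
      gexec w inp (GWhile (Bin Lt (Reg r) (Reg 0))
        (GSeq g (GAssign r (Bin Add (Reg r) (Cst 1))))) rho' rho''
        (flat_map f (seq i j)) k /\ k <= j * (m + 2) + 1 /\ agree r rho rho'').
  { assert (Htest : forall rho' i, agree r rho rho' -> rho' r = i ->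
      eval w (State rho' inp) (Bin Lt (Reg r) (Reg 0)) = Nat.b2n (i <? n)).
    { intros rho' i Ag Hi; cbn [eval eval_binop reg].
      rewrite Hi, Ag, H0 by lia; apply Nat.mod_small.
      destruct (i <? n); simpl; lia. }
    induction j as [| j IH]; intros i rho' Hij Ag Hi.
    - exists rho', 1; split; [| split; [lia | easy]].
      apply gexec_while_false; rewrite (Htest _ i) by easy.
      destruct (Nat.ltb_spec i n); [lia | easy].
    - destruct (Hg i rho') as (rho1 & k1 & E1 & Hk1 & Ag1); [lia | easy | easy |].
      set (rho2 := fun q => if q =? r
        then eval w (State rho1 inp) (Bin Add (Reg r) (Cst 1)) else rho1 q).
      destruct (IH (S i) rho2) as (rho3 & k3 & E3 & Hk3 & Ag3); [lia | | |].
      + intros q Hq; unfold rho2; destruct (Nat.eqb_spec q r); [lia |].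
        rewrite Ag1 by lia; now apply Ag.
      + unfold rho2; rewrite Nat.eqb_refl; cbn [eval eval_binop reg].
        rewrite Ag1, Hi by lia; rewrite (Nat.mod_small 1) by lia.
        rewrite Nat.mod_small; [lia | nia].
      + exists rho3, (S ((k1 + 1) + k3)); split; [| split; [lia | easy]].
        cbn [seq flat_map]; eapply gexec_while_true with (rho1 := rho2); [| | exact E3].
        * rewrite (Htest _ i) by easy.
          destruct (Nat.ltb_spec i n); [easy | lia].
        * rewrite <- (app_nil_r (f i)); econstructor; [exact E1 | constructor]. }
  destruct (loop n 0 (fun q => if q =? r then eval w (State rho inp) (Cst 0) else rho q))
    as (rho' & k & E & Hk & Ag).
  - lia.
  - intros q Hq; destruct (Nat.eqb_spec q r); [lia | easy].
  - rewrite Nat.eqb_refl; apply eval_cst; lia.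
  - exists rho', (1 + k); split; [| split; [lia | easy]].
    change (flat_map f (seq 0 n)) with ([] ++ flat_map f (seq 0 n)).
    econstructor; [constructor | exact E].
Qed.

Lemma emits_block r rho a i : r <= 4 ->
  rho 0 = n -> rho 1 = order n -> rho 2 = a -> rho 3 = i -> a < n -> i < n ->
  emits r (glue_block d) rho (flat_map (send_ops d n) (block A a i)) 27.
Proof.
  (* Ten spokes and three links at two stores each, and one adjacency test. *)
  intros Hr H0 H1 H2 H3 Ha Hi; apply emits_weaken with (r' := 4) (m := 10 * 2 + S (3 * 2));
    [| lia | lia].
  assert (sends : forall (l : list (edge exp)) (rho' : nat -> nat), agree 4 rho rho' ->
    incl l (spokes (Reg 2) (Reg 3) ++ links (Reg 2) (Reg 3)) ->
    emits 4 (glue_list (map (glue_send d) l)) rho'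
      (flat_map (send_ops d n) (map (edge_map (eval w (State rho inp))) l))
      (length l * 2)).
  { intros l rho1 Ag1 Hl; apply emits_list; intros e rho2 He Ag2.
    assert (Ev : forall q, q < 4 -> rho2 q = rho q)
      by (intros q Hq; rewrite Ag2, Ag1; auto).
    assert (Em : edge_map (eval w (State rho inp)) e =
        edge_map (eval w (State rho2 inp)) e /\
        wf (edge_map (eval w (State rho2 inp)) e)).
    { apply Hl in He; simpl in He.
      repeat (destruct He as [<- | He];
        [unfold wf; simpl; rewrite !Ev by lia; rewrite ?H2, ?H3; repeat split; lia |]).
      easy. }
    destruct Em as [-> We].
    apply emits_send; [rewrite Ev by lia; easy | rewrite Ev by lia; easy | easy]. }
  unfold glue_block, block; rewrite flat_map_app, flat_map_if.
  apply emits_seq.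
  - replace (spokes a i)
      with (map (edge_map (eval w (State rho inp))) (spokes (Reg 2) (Reg 3)))
      by (simpl; now rewrite H2, H3).
    apply sends; [easy | now apply incl_appl].
  - intros rho' Ag; apply emits_if_edge; try (rewrite Ag by lia); try easy.
    replace (links a i)
      with (map (edge_map (eval w (State rho inp))) (links (Reg 2) (Reg 3)))
      by (simpl; now rewrite H2, H3).
    apply sends; [easy | now apply incl_appr].
Qed.

Definition switch_pieces : list (option (edge exp)) :=
  filter_on (Reg 2) (Reg 3) ++ gate_on (Reg 2) (Reg 3) ++
  test_gate_off (Reg 2) (Reg 3) ++ filter_off (Reg 2) (Reg 3).

Lemma emits_pieces rho a i l (l' : list (option (edge nat))) :
  rho 0 = n -> rho 2 = a -> rho 3 = i -> a < n -> i < n -> incl l switch_pieces ->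
  map (option_map (edge_map (eval w (State rho inp)))) l = l' ->
  emits 4 (glue_steps d l) rho (flat_map (step_ops d n) l') (length l * 3).
Proof.
  intros H0 H2 H3 Ha Hi Hl <-; apply emits_steps; [lia | easy |].
  intros rho' e Ag He; apply Hl in He; simpl in He.
  repeat (destruct He as [E | He];
    [inversion E; subst e; unfold wf; simpl; rewrite !Ag by lia; rewrite ?H2, ?H3;
      repeat split; lia |]).
  easy.
Qed.

(** Every scheduled item is charged 3, for the three arguments of an update. The bodies of the three
    loops then cost 7, [7 + 9] and 6, where 7 includes an adjacency test. *)
Lemma emits_phase rho a : rho 0 = n -> rho 2 = a -> a < n ->
  emits 3 (glue_phase d) rho (flat_map (step_ops d n) (phase n A a)) (35 * n + 6).
Proof.
  intros H0 H2 Ha; unfold glue_phase, phase.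
  rewrite !flat_map_app, !flat_map_flat_map.
  eapply emits_weaken with (r' := 3)
    (m := (n * (7 + 2) + 2) + ((n * (16 + 2) + 2) + (n * (6 + 2) + 2))); [| lia |].
  2: lia.
  apply emits_seq; [| intros rho1 Ag1; apply emits_seq; [| intros rho2 Ag2]].
  - apply emits_for; [lia | easy |]; intros i rho' Hi Ag H3.
    unfold opening; rewrite flat_map_if.
    apply emits_if_edge; try (rewrite Ag by lia); try easy.
    apply (emits_pieces rho' a i); try (rewrite Ag by lia); try easy.
    + now apply incl_appl.
    + simpl; rewrite Ag by lia; now rewrite H2, H3.
  - apply emits_for; [lia | rewrite Ag1 by lia; easy |]; intros i rho' Hi Ag H3.
    assert (Ev : forall q, q < 3 -> rho' q = rho q)
      by (intros q Hq; rewrite Ag, Ag1; auto).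
    unfold query, gate; rewrite flat_map_app, flat_map_if.
    apply (emits_seq 4 _ _ _ _ _ 7 9).
    + apply emits_if_edge; try (rewrite Ev by lia); try easy.
      apply (emits_pieces rho' a i); try (rewrite Ev by lia); try easy.
      * now apply incl_appr, incl_appl.
      * simpl; rewrite Ev by lia; now rewrite H2, H3.
    + intros rho3 Ag3.
      apply (emits_pieces rho3 a i); try (rewrite Ag3, ?Ev by lia); try easy.
      * now apply incl_appr, incl_appr, incl_appl.
      * simpl; rewrite !Ag3, Ev by lia; now rewrite H2, H3.
  - apply emits_for; [lia | rewrite Ag2, Ag1 by lia; easy |]; intros i rho' Hi Ag H3.
    assert (Ev : forall q, q < 3 -> rho' q = rho q)
      by (intros q Hq; rewrite Ag, Ag2, Ag1; auto).
    apply (emits_pieces rho' a i); try (rewrite Ev by lia); try easy.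
    + now apply incl_appr, incl_appr, incl_appr.
    + simpl; rewrite Ev by lia; now rewrite H2, H3.
Qed.

(** Two double loops with constant work per pair; the bounds add up to [64 * n ^ 2 + 12 * n + 8]. *)
Lemma reduction_emits rho : rho 0 = n ->
  exists rho' k, gexec w inp (reduction d) rho rho' (reduction_trace d n A) k /\
    k <= 100 * ((n + 1) * (n + 1)).
Proof.
  intros H0.
  set (rho1 := fun q => if q =? 1 then eval w (State rho inp) (lin 16 (Cst 2)) else rho q).
  assert (H1 : rho1 1 = order n).
  { unfold rho1, order; simpl Nat.eqb; cbv iota; solve_eval. }
  assert (H01 : rho1 0 = n) by easy.
  assert (main : emits 2
    (GSeq (GSeq (GArg 0 (Reg 1)) (GSeq (GArg 1 (lin 16 (Cst 0))) (GArg 2 (lin 16 (Cst 1)))))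
       (GSeq (glue_for 2 (glue_for 3 (glue_block d)))
          (GSeq GInit (glue_for 2 (glue_phase d)))))
    rho1 (reduction_trace d n A)
    (3 + ((n * ((n * (27 + 2) + 2) + 2) + 2) + (0 + (n * ((35 * n + 6) + 2) + 2))))).
  { unfold reduction_trace; apply emits_seq.
    - exists rho1, 3; split; [| split; [lia | easy]].
      replace (order n) with (eval w (State rho1 inp) (Reg 1)) by easy.
      replace (code n Source) with (eval w (State rho1 inp) (lin 16 (Cst 0)))
        by (cbn -[Nat.mul lin eval]; solve_eval).
      replace (code n Sink) with (eval w (State rho1 inp) (lin 16 (Cst 1)))
        by (cbn -[Nat.mul lin eval]; solve_eval).
      exact (gexec_seq w inp _ _ rho1 rho1 rho1 _ _ _ _ (gexec_arg w inp 0 _ rho1)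
        (gexec_seq w inp _ _ rho1 rho1 rho1 _ _ _ _ (gexec_arg w inp 1 _ rho1)
          (gexec_arg w inp 2 _ rho1))).
    - intros rho2 Ag2; apply emits_seq; [| intros rho3 Ag3; apply emits_seq].
      + unfold edges; rewrite flat_map_flat_map.
        apply emits_for; [lia | rewrite Ag2 by lia; easy |].
        intros a rho3 Ha Ag3 Ea; rewrite flat_map_flat_map.
        apply emits_for; [lia | rewrite Ag3, Ag2 by lia; easy |].
        intros i rho4 Hi Ag4 Ei; apply emits_block; try easy.
        * rewrite Ag4, Ag3, Ag2 by lia; easy.
        * rewrite Ag4, Ag3, Ag2 by lia; easy.
        * rewrite Ag4 by lia; easy.
      + exists rho3, 0; split; [constructor | easy].
      + intros rho4 Ag4; unfold schedule; rewrite flat_map_flat_map.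
        apply emits_for; [lia | rewrite Ag4, Ag3, Ag2 by lia; easy |].
        intros a rho5 Ha Ag5 Ea; apply emits_phase; try easy.
        rewrite Ag5, Ag4, Ag3, Ag2 by lia; easy. }
  destruct main as (rho' & k & E & Hk & _).
  exists rho', (1 + k); split; [| nia].
  unfold reduction; change (reduction_trace d n A) with ([] ++ reduction_trace d n A).
  apply gexec_seq with rho1; [constructor | exact E].
Qed.

End Glue.

(** * The reduction as a 4-Clique algorithm *)

Lemma somes_length {T : Type} (l : list (option T)) : length (somes l) <= length l.
Proof. induction l as [| [x |] l IH]; simpl; lia. Qed.

Lemma accepted_spec N G s t st bound :
  earliest_arrival N G s t (ea_output st) ->
  accepted st bound = true <-> accepts N G s t bound.
Proof.
  unfold ea_output, accepted, earliest_arrival, accepts.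
  destruct (Nat.eqb_spec (reg st 6) 0) as [_ | _]; simpl.
  - intros H; split; [easy |]; intros (p & Hp & _); now destruct (H p).
  - intros [(p & Hp & Ep) Hmin]; rewrite Nat.leb_le; split.
    + intros Hle; exists p; split; [easy | lia].
    + intros (q & Hq & Hle); specialize (Hmin q Hq); lia.
Qed.

(** The flag [b] is arbitrary because acceptance accumulates. Updates consume the derivation of
    [maintains], tests only use the correctness of the current output and are paid for by
    [3 * length l]. *)
Lemma play_schedule D d n w s t (l : list (option (edge nat))) :
  forall G st b k,
  maintains D (order n) s t w G st
    (map (set_weight n (final_weight d n)) (somes l)) k ->
  exists st' b' k', play D w st b (flat_map (step_ops d n) l) st' b' k' /\
    k' <= k + 3 * length l /\
    (b' = true <-> b = true \/ exists l1 l2, l = l1 ++ None :: l2 /\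
      accepts (order n)
        (apply_all (map (set_weight n (final_weight d n)) (somes l1)) G)
        s t (5 * n)).
Proof.
  induction l as [| [e |] l IH]; intros G st b k H.
  - exists st, b, 0; repeat split; [constructor | lia | tauto |].
    intros [-> | (l1 & l2 & E & _)]; [easy |]; now destruct l1.
  - cbn [somes flat_map app map] in H.
    inversion H as [| G0 st0 z us st1 k1 k2 He E H' Hz Hk]; subst.
    destruct (IH _ _ b _ H') as (st' & b' & k' & P & Hk' & Hb).
    exists st', b', (k1 + k'); split; [| split; [simpl; lia |]].
    (* The three [OArg] operations build exactly [upd_input]. *)
    + repeat constructor; econstructor; [exact E | exact P].
    + rewrite Hb; split; (intros [-> | (l1 & l2 & El & Ha)]; [now left | right]).
      * subst l; exists (Some e :: l1), l2; split; [reflexivity | exact Ha].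
      * destruct l1 as [| o l1]; inversion El; subst.
        exists l1, l2; split; [reflexivity | exact Ha].
  (* Both constructors of [maintains] provide this, so a test may also come after the last
     update. *)
  - assert (He : earliest_arrival (order n) G s t (ea_output st))
      by now inversion H.
    destruct (IH _ _ (b || accepted st (5 * n)) _ H) as (st' & b' & k' & P & Hk' & Hb).
    exists st', b', (3 + k'); split; [| split; [simpl; lia |]].
    + constructor; exact P.
    + rewrite Hb, orb_true_iff, (accepted_spec _ _ _ _ _ _ He); split.
      * intros [[-> | Ha] | (l1 & l2 & -> & Ha)]; [now left | |]; right.
        -- exists [], l; split; [reflexivity | exact Ha].
        -- exists (None :: l1), l2; split; [reflexivity | exact Ha].
      * intros [-> | (l1 & l2 & E & Ha)]; [now left; left |].
        destruct l1 as [| o l1]; inversion E; subst.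
        -- left; right; exact Ha.
        -- right; exists l1, l2; split; [reflexivity | exact Ha].
Qed.

(** Allows the input of [init] to be built edge by edge: by division with remainder, [u * N + v] is
    the only position that decodes to [(u, v)]. *)
Lemma ea_input_add N G s t u v x : u < N -> v < N ->
  set_arr 1 (u * N + v) x (set_arr 0 (u * N + v) 1 (ea_input N G s t)) =
  ea_input N (apply_upd ((u, v), x) G) s t.
Proof.
  intros Hu Hv; unfold set_arr, ea_input, apply_upd; cbn [reg arr fst snd]; f_equal.
  apply functional_extensionality; intros a.
  apply functional_extensionality; intros p.
  assert (HN : u * N + v < N * N) by nia.
  destruct (Nat.eqb_spec p (u * N + v)) as [-> | Hp].
  - apply Nat.ltb_lt in HN; rewrite HN.
    rewrite Nat.div_add_l, (Nat.div_small v), Nat.add_0_r by lia.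
    rewrite (Nat.add_comm (u * N)), Nat.Div0.mod_add, Nat.mod_small by lia.
    rewrite !Nat.eqb_refl; destruct a as [| [| a]]; simpl;
      try easy; destruct (G u v); easy.
  - rewrite !andb_false_r.
    destruct (Nat.ltb_spec p (N * N)) as [Hlt |]; [| easy].
    replace ((p / N =? u) && (p mod N =? v)) with false; [easy |].
    symmetry; apply andb_false_iff; rewrite !Nat.eqb_neq.
    pose proof (Nat.div_mod_eq p N) as E.
    destruct (Nat.eq_dec (p / N) u) as [Eu |]; [right | now left].
    intros E'; apply Hp; rewrite E', Eu, Nat.mul_comm in E; exact E.
Qed.

Lemma play_sends D d n w s t b (l : list (edge nat)) A :
  (forall e, In e l -> edge_wf n A e) -> forall G,
  play D w (ea_input (order n) G s t) b (flat_map (send_ops d n) l)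
    (ea_input (order n)
       (apply_all (map (set_weight n (initial_weight d n)) l) G) s t) b 0.
Proof.
  induction l as [| e l IH]; intros Hl G; [constructor |].
  assert (We : edge_wf n A e) by (apply Hl; now left).
  cbn [flat_map send_ops map apply_all app]; do 2 constructor.
  rewrite ea_input_add.
  - apply IH; intros e' He'; apply Hl; now right.
  - eapply code_lt, src_wf, We.
  - eapply code_lt, dst_wf, We.
Qed.

Lemma ea_input_empty N s t :
  set_reg 2 t (set_reg 1 s (set_reg 0 N (State (fun _ => 0) (fun _ _ => 0)))) =
  ea_input N (fun _ _ => None) s t.
Proof.
  unfold set_reg, ea_input; cbn [reg arr]; f_equal.
  - apply functional_extensionality; intros [| [| [| r]]]; reflexivity.
  - apply functional_extensionality; intros a.
    apply functional_extensionality; intros p.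
    now destruct (p <? N * N), a as [| [| a]].
Qed.

Definition updates (d : direction) (n : nat) (A : nat -> nat -> bool) : list upd :=
  map (set_weight n (final_weight d n)) (somes (schedule n A)).

Lemma run_reduction D d n A w k :
  simple_graph n A -> 256 * ((n + 1) * (n + 1)) <= 2 ^ w ->
  ea_run D (order n) w (initial_graph d n A) (code n Source) (code n Sink)
    (updates d n A) k ->
  exists st k', exec w (inline D (reduction d)) (clique_input n A) st k' /\
    k' <= k + 127 * ((n + 1) * (n + 1)) /\ (reg st 2 <> 0 <-> has_4clique n A).
Proof.
  intros HA Hfit (st1 & k0 & k1 & E0 & M & ->).
  assert (Hw : 0 < w) by (destruct w; [simpl in Hfit; nia | lia]).
  set (inp := fun a => arr (clique_input n A) (glue_name a)).
  set (rho := fun r => reg (clique_input n A) (glue_name r)).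
  assert (Hinp : forall a i, a < n -> i < n -> inp 0 (a * n + i) = Nat.b2n (A a i)).
  { intros a i Ha Hi; unfold inp; simpl.
    assert (H : a * n + i < n * n) by nia.
    apply Nat.ltb_lt in H; rewrite H.
    rewrite Nat.div_add_l, (Nat.div_small i), Nat.add_0_r by lia.
    now rewrite (Nat.add_comm (a * n)), Nat.Div0.mod_add, Nat.mod_small by lia. }
  destruct (reduction_emits d n w A inp Hfit Hinp rho eq_refl) as (rho' & kg & Eg & Hkg).
  destruct (play_schedule D d n w _ _ (schedule n A) _ _ false _ M)
    as (st2 & b & k2 & P & Hk2 & Hb).
  assert (P' : play D w (State (fun _ => 0) (fun _ _ => 0)) false
    (reduction_trace d n A) st2 b (0 + (k0 + k2))).
  { unfold reduction_trace; cbn [app]; do 3 constructor.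
    rewrite ea_input_empty; eapply play_app.
    - apply play_sends with A; intros e; apply in_edges.
    - econstructor; [exact E0 | exact P]. }
  (* The clique input sits in register 0 and array 0, which are glue names; the dynamic algorithm
     therefore starts from an all-zero state. *)
  assert (Lk : linked (clique_input n A) rho inp (State (fun _ => 0) (fun _ _ => 0)) false).
  { repeat split; unfold view; f_equal.
    - apply functional_extensionality; intros r; simpl.
      destruct (Nat.eqb_spec (dyn_name r) 0) as [E |]; [unfold dyn_name in E; lia | easy].
    - apply functional_extensionality; intros r; simpl.
      destruct (Nat.eqb_spec (dyn_name r) 0) as [E |]; [unfold dyn_name in E; lia | easy]. }
  destruct (inline_play D w inp _ _ _ _ _ Hw Eg _ _ _ _ _ _ Lk P')
    as (st' & k' & E' & Hk' & L').
  exists st', k'; split; [easy |]; split.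
  (* The 127 consists of 100 for the glue code and 3 for each of at most [9 * (n * n)] scheduled
     items. *)
  - pose proof (schedule_length n A); nia.
  - destruct L' as (_ & _ & ->).
    rewrite <- (queries_decide d n A HA).
    transitivity (b = true); [destruct b; simpl; split; easy |].
    rewrite Hb; split; [intros [? | H]; [easy | exact H] | now right].
Qed.

(** With [l = S (Nat.log2 n)], the constant 10 pays for a factor 256 and two factors [n + 1], each
    at most [2 ^ l]. The factor 6 arises because [S (Nat.log2 (order n))] is at most [6 * l]. *)
Lemma reduction_word_size c n w : word_size (10 + 6 * c) n w ->
  256 * ((n + 1) * (n + 1)) <= 2 ^ w /\ word_size c (order n) w.
Proof.
  unfold word_size; intros H.
  assert (Hn : n < 2 ^ S (Nat.log2 n)).
  { destruct n as [| n]; [simpl; lia |]. apply Nat.log2_spec; lia. }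
  assert (Hl : Nat.log2 (order n) <= 5 + Nat.log2 n).
  { destruct n as [| n]; [apply Nat.leb_le; reflexivity |].
    rewrite <- Nat.log2_mul_pow2 by lia.
    apply Nat.log2_le_mono; unfold order; change (2 ^ 5) with 32; lia. }
  set (l := S (Nat.log2 n)) in *; split.
  - apply Nat.le_trans with (2 ^ (8 * l + (l + l))).
    + rewrite !Nat.pow_add_r; apply Nat.mul_le_mono.
      * change 256 with (2 ^ 8); apply Nat.pow_le_mono_r; lia.
      * apply Nat.mul_le_mono; lia.
    + apply Nat.pow_le_mono_r; lia.
  - apply Nat.le_trans with (c * (6 * l)); [| lia].
    apply Nat.mul_le_mono_l; lia.
Qed.

Lemma reduction_legal d once n A w : 256 * ((n + 1) * (n + 1)) <= 2 ^ w ->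
  legal_instance d once (order n) w (initial_graph d n A) (code n Source)
    (code n Sink) (updates d n A).
Proof.
  intros Hfit; apply legal_reduction;
    [nia | apply schedule_NoDup | apply schedule_switches].
Qed.

Lemma reduction_black_box d once : black_box_reduction d once (reduction d).
Proof.
  intros D (c & HD); exists (10 + 6 * c); intros n A w HA Hw.
  apply reduction_word_size in Hw as [Hfit Hw].
  destruct (HD _ w _ _ _ _ Hw (reduction_legal d once n A w Hfit)) as (k & Hrun).
  destruct (run_reduction D d n A w k HA Hfit Hrun) as (st & k' & E & _ & H).
  now exists st, k'.
Qed.

Definition reduction_time (U : nat -> nat) (n : nat) : nat :=
  U (order n) * (order n ^ 2 + 9 * (n * n)) + 127 * ((n + 1) * (n + 1)).

Lemma reduction_clique_time d once D U :
  solves_stEA d once D -> amortized_update_time d once D U ->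
  clique_time (inline D (reduction d)) (reduction_time U).
Proof.
  (* The sum serves both the correctness and the time guarantee of [D]. *)
  intros (c & HD) (c' & HU); exists (10 + 6 * (c + c')).
  intros n A w st k HA Hw E.
  apply reduction_word_size in Hw as [Hfit Hw].
  assert (Hc : word_size c (order n) w) by (unfold word_size in *; lia).
  assert (Hc' : word_size c' (order n) w) by (unfold word_size in *; lia).
  pose proof (reduction_legal d once n A w Hfit) as Leg.
  destruct (HD _ _ _ _ _ _ Hc Leg) as (k1 & Hrun).
  destruct (run_reduction D d n A w k1 HA Hfit Hrun) as (st' & k' & E' & Hk' & _).
  destruct (exec_deterministic _ _ _ _ _ _ _ E E') as [_ ->].
  specialize (HU _ _ _ _ _ _ _ Hc' Leg Hrun).
  assert (Hlen : length (updates d n A) <= 9 * (n * n)).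
  { unfold updates; rewrite length_map.
    apply Nat.le_trans with (length (schedule n A)); [| apply schedule_length].
    apply somes_length. }
  unfold reduction_time.
  apply Nat.le_trans with (1 := Hk'), Nat.add_le_mono_r, Nat.le_trans with (1 := HU).
  apply Nat.mul_le_mono_l; lia.
Qed.

(** * Asymptotics of the running time *)

Lemma bigO_pow_constant_ge0 (T : nat -> nat) (e C : R) :
  (INR (T 1%nat) <= C * Rpower (INR 1) e)%R -> (0 <= C)%R.
Proof.
  intros HC; pose proof (pos_INR (T 1%nat)) as H.
  unfold Rpower in HC; simpl INR in HC; rewrite ln_1, Rmult_0_r, exp_0 in HC; lra.
Qed.

(** About [n ^ 2] updates at cost [n ^ (2 - e)] each. The bound on [e] makes [2 - e] nonnegative, so
    that powers are monotone in the base, and lets [n ^ (4 - e)] absorb the quadratic overhead. *)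
Lemma reduction_time_bigO (U : nat -> nat) (e : R) : (e <= 1)%R ->
  bigO_pow U (2 - e) -> bigO_pow (reduction_time U) (4 - e).
Proof.
  intros He (C & HC).
  pose proof (bigO_pow_constant_ge0 U _ C (HC 1 (le_n 1))) as C0.
  (* For positive [n], [order n] is at most [18 * n]. *)
  set (K := Rpower 18 (2 - e)).
  exists (333 * C * K + 508)%R; intros n Hn.
  set (x := INR n); assert (Hx : (1 <= x)%R) by (apply (le_INR 1); lia).
  assert (HU : (INR (U (order n)) <= C * (K * Rpower x (2 - e)))%R).
  { eapply Rle_trans; [apply HC; unfold order; lia |].
    apply Rmult_le_compat_l; [easy |].
    unfold K; rewrite Rpower_mult_distr by lra.
    apply Rle_Rpower_l; [lra |]; split; [apply (lt_INR 0); unfold order; lia |].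
    replace (18 * x)%R with (INR (18 * n)) by (unfold x; rewrite mult_INR; simpl; lra).
    apply le_INR; unfold order; lia. }
  assert (HT : (INR (reduction_time U n) <= INR (U (order n)) * (333 * x ^ 2) + 508 * x ^ 2)%R).
  (* Here [333 = 18 ^ 2 + 9], and [508 = 127 * 4] since [n + 1 <= 2 * n]. *)
  { assert (H : reduction_time U n <= U (order n) * (333 * n ^ 2) + 508 * n ^ 2).
    { unfold reduction_time; apply Nat.add_le_mono;
        [apply Nat.mul_le_mono_l |]; unfold order; simpl; nia. }
    apply le_INR in H; rewrite plus_INR, !mult_INR, !pow_INR in H; fold x in H.
    replace (INR 333) with 333%R in H by (rewrite INR_IZR_INZ; reflexivity).
    replace (INR 508) with 508%R in H by (rewrite INR_IZR_INZ; reflexivity).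
    exact H. }
  assert (H2 : (x ^ 2 = Rpower x 2)%R)
    by (rewrite <- Rpower_pow by lra; f_equal; simpl; lra).
  assert (H4 : (Rpower x (2 - e) * Rpower x 2 = Rpower x (4 - e))%R)
    by (rewrite <- Rpower_plus; f_equal; lra).
  assert (H24 : (Rpower x 2 <= Rpower x (4 - e))%R) by (apply Rle_Rpower; lra).
  assert (P2 : (0 < Rpower x 2)%R) by apply exp_pos.
  rewrite H2 in HT.
  apply Rmult_le_compat_r with (r := (333 * Rpower x 2)%R) in HU; [| lra].
  replace (C * (K * Rpower x (2 - e)) * (333 * Rpower x 2))%R
    with (333 * C * K * (Rpower x (2 - e) * Rpower x 2))%R in HU by ring.
  rewrite H4 in HU; fold x; lra.
Qed.

Lemma bigO_pow_weaken (T : nat -> nat) (e e' : R) : (e <= e')%R ->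
  bigO_pow T e -> bigO_pow T e'.
Proof.
  intros He (C & HC).
  pose proof (bigO_pow_constant_ge0 T _ C (HC 1 (le_n 1))) as C0.
  exists C; intros n Hn; eapply Rle_trans; [now apply HC |].
  apply Rmult_le_compat_l; [easy |].
  apply Rle_Rpower; [apply (le_INR 1); lia | easy].
Qed.

Theorem theorem5p4
  (comb : cmd -> Prop) (comb_dyn : dyn_alg -> Prop)
  (Hcomb : combinatorial_notion comb comb_dyn)
  (H4clique : combinatorial_4clique_hypothesis comb)
  (d : direction) (once : bool)
  (D : dyn_alg) (HDcomb : comb_dyn D) (HD : solves_stEA d once D)
  (U : nat -> nat) (HU : amortized_update_time d once D U) :
  at_least_quadratic_up_to_subpoly U.
Proof.
  intros eps Heps HO.
  (* Capping the exponent gain at 1 meets the side condition of [reduction_time_bigO]; a smaller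
     gain follows from a larger one. *)
  assert (He : (0 < Rmin eps 1)%R) by (apply Rmin_pos; lra).
  apply (H4clique _ He).
  exists (inline D (reduction d)), (reduction_time U); repeat split.
  - exact (Hcomb d once D (reduction d) HDcomb HD (reduction_black_box d once)).
  - exact (reduction_black_box d once D HD).
  - exact (reduction_clique_time d once D U HD HU).
  - apply reduction_time_bigO; [apply Rmin_r |].
    apply bigO_pow_weaken with (2 := HO).
    pose proof (Rmin_l eps 1); lra.
Qed.
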